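(* Let $(\Omega,\mu)$ be a measure space with $\mu$ continuous and $\mu\Omega<\infty$. Let $X$ be a real reflexive Banach lattice of measurable functions on $\Omega$ such that $L^\infty(\mu)\subset X\subset L^1(\mu)$ and $X^*=\{h:\ hf\in L^1(\mu)\ \forall f\in X\}$ with the duality $(f,h)=\int_\Omega fh\,d\mu$. Let $U=(u_k)_{k\ge1}$ be a normalized unconditional basis in $X$. Then for every $E\subset\Omega$ with $\mu E>0$, $$\Big(\int_E u_k^+\,d\mu\Big)_{k\ge1}\notin(\mathrm{Coef}(U))^*\quad\text{and}\quad\Big(\int_E u_k^-\,d\mu\Big)_{k\ge1}\notin(\mathrm{Coef}(U))^*.$$
   Context: Let $U'=(u_k')_{k\ge1}$ be the dual (biorthogonal) system, $(u_k,u_j')=\delta_{kj}$, so that $f=\sum_{k\ge1}(f,u_k')u_k$ for every $f\in X$. $\mathrm{Coef}(U)=\{((f,u_k'))_{k\ge1}:\ f\in X\}$ is the sequence space of coefficients (normed by the norm of the corresponding $f$), and $(\mathrm{Coef}(U))^*$ is its dual with respect to the duality $(a,b)=\sum_{k\ge1}a_kb_k$ (it equals $\mathrm{Coef}(U')$). For a real function $u$, $u^{\pm}=\max(0,\pm u)$. *)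

(* Defs.v *)
From HB Require Import structures.
From mathcomp Require Import all_boot all_order all_algebra.
From mathcomp Require Import all_classical all_reals all_analysis.
Unset Printing Implicit Defensive.
Import Order.TTheory GRing.Theory Num.Theory.
Import numFieldNormedType.Exports.
Local Open Scope classical_set_scope.
Local Open Scope ring_scope.

Section Defs.
Context {d : measure_display} {T : measurableType d} {R : realType}.
Variable mu : {measure set T -> \bar R}.

Definition atomless : Prop :=
  forall A, measurable A -> (0 < mu A)%E ->
    exists B, [/\ measurable B, B `<=` A, (0 < mu B)%E & (mu B < mu A)%E].

(* X (a set of measurable real functions on T) with the (semi)norm nrm
   (zero exactly on a.e.-null functions) is a real Banach lattice of
   measurable functions (a Banach ideal space / Koethe function space). *)
Definition banach_function_lattice (X : set (T -> R)) (nrm : (T -> R) -> R)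
  : Prop :=
  [/\ [/\ (forall f, X f -> measurable_fun setT f),
      X (fun _ => 0),
      (forall f g, X f -> X g -> X (fun x => f x + g x)) &
      (forall c f, X f -> X (fun x => c * f x))],
      [/\ (forall f, X f -> 0 <= nrm f),
      (forall f g, X f -> X g -> nrm (fun x => f x + g x) <= nrm f + nrm g),
      (forall c f, X f -> nrm (fun x => c * f x) = `|c| * nrm f) &
      (forall f, X f -> nrm f = 0 <-> {ae mu, forall x, f x = 0})],
      (forall f g : T -> R, X g -> measurable_fun setT f ->
         {ae mu, forall x, `|f x| <= `|g x|} -> X f /\ nrm f <= nrm g) &
      (forall g : nat -> T -> R, (forall n, X (g n)) ->
         (forall e : R, 0 < e -> exists N, forall m n, (N <= m)%N -> (N <= n)%N ->
            nrm (fun x => g m x - g n x) < e) ->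
         exists f, X f /\ (fun n => nrm (fun x => g n x - f x)) @ \oo --> (0 : R))].

Definition Linfty_sub (X : set (T -> R)) : Prop :=
  forall f : T -> R, measurable_fun setT f ->
    (exists M : R, {ae mu, forall x, `|f x| <= M}) -> X f.

Definition sub_L1 (X : set (T -> R)) : Prop :=
  forall f, X f -> mu.-integrable setT (EFin \o f).

Definition pairing (f h : T -> R) : R := Rintegral mu setT (fun x => f x * h x).

Definition kothe_dual (X : set (T -> R)) : set (T -> R) :=
  [set h | measurable_fun setT h /\
     forall f, X f -> mu.-integrable setT (EFin \o (fun x => f x * h x))].

Definition linear_on (X : set (T -> R)) (phi : (T -> R) -> R) : Prop :=
  (forall f g, X f -> X g -> phi (fun x => f x + g x) = phi f + phi g) /\
  (forall c f, X f -> phi (fun x => c * f x) = c * phi f).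

Definition bounded_on (X : set (T -> R)) (nrm : (T -> R) -> R)
  (phi : (T -> R) -> R) : Prop :=
  exists C : R, forall f, X f -> `|phi f| <= C * nrm f.

Definition dual_is_kothe (X : set (T -> R)) (nrm : (T -> R) -> R) : Prop :=
  (forall h, kothe_dual X h -> bounded_on X nrm (fun f => pairing f h)) /\
  (forall phi, linear_on X phi -> bounded_on X nrm phi ->
     exists h, kothe_dual X h /\ forall f, X f -> phi f = pairing f h).

(* Reflexivity: every bounded linear functional Psi on X^* (identified with
   the Koethe dual, normed by the dual norm
   ||h|| = inf {D | forall f in X, |(f,h)| <= D ||f||}) is the evaluation
   h |-> (f, h) at some f in X. *)
Definition reflexive_space (X : set (T -> R)) (nrm : (T -> R) -> R) : Prop :=
  forall Psi : (T -> R) -> R, linear_on (kothe_dual X) Psi ->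
    (exists C : R, forall h, kothe_dual X h -> forall D : R,
        (forall f, X f -> `|pairing f h| <= D * nrm f) -> `|Psi h| <= C * D) ->
    exists f, X f /\ forall h, kothe_dual X h -> Psi h = pairing f h.

Definition is_coef (nrm : (T -> R) -> R) (u : nat -> T -> R) (f : T -> R)
  (a : nat -> R) : Prop :=
  (fun n => nrm (fun x => f x - \sum_(k < n) a k * u k x)) @ \oo --> (0 : R).

Definition normalized_unconditional_basis (X : set (T -> R))
  (nrm : (T -> R) -> R) (u : nat -> T -> R) : Prop :=
  [/\ (forall k, X (u k)),
      (forall k, nrm (u k) = 1),
      (forall f, X f -> exists a, is_coef nrm u f a),
      (forall f a b, X f -> is_coef nrm u f a -> is_coef nrm u f b -> a = b) &
      (forall f a (s : nat -> nat), X f -> is_coef nrm u f a -> bijective s ->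
         (fun n => nrm (fun x => f x - \sum_(k < n) a (s k) * u (s k) x))
            @ \oo --> (0 : R))].

(* b belongs to (Coef(U))^*, the dual of the coefficient space Coef(U)
   (normed by the norm of the corresponding f) w.r.t. (a,b) = sum_k a_k b_k:
   the series converges for every a in Coef(U) and defines a bounded
   functional. *)
Definition in_coef_dual (X : set (T -> R)) (nrm : (T -> R) -> R)
  (u : nat -> T -> R) (b : nat -> R) : Prop :=
  (forall f a, X f -> is_coef nrm u f a ->
     cvg ((fun n => \sum_(k < n) a k * b k) @ \oo)) /\
  (exists C : R, forall f a, X f -> is_coef nrm u f a ->
     `|lim ((fun n => \sum_(k < n) a k * b k) @ \oo)| <= C * nrm f).

End Defs.

(* Main.v *)
(** If the positive (or negative) parts gave an element of the dual of the
coefficient space, then, as [|t| = 2 t^+ - t = 2 t^- + t], so would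
[b_k = \int_E |u_k|]. By unconditionality and Riemann rearrangement,
[\sum_k |a_k| b_k] is then finite for the coefficients [a] of every [f] in [X],
and a Baire category argument makes [f |-> (a_k b_k)_k] a bounded operator from
[X] to [l^1]. Rademacher functions [r_n] on [E] are weakly null in [X], because
functionals on [X] are given by [L^1] functions, so by Schur's theorem the
[l^1] norms of their images tend to 0. But those norms dominate
[\int_E |r_n| = mu E]. *)
Require Import Defs.
From HB Require Import structures.
From mathcomp Require Import all_boot all_order all_algebra.
From mathcomp Require Import all_classical all_reals all_analysis.
From mathcomp Require Import measurable_realfun zify ring lra.
Import Order.TTheory GRing.Theory Num.Theory.
Import numFieldNormedType.Exports HBSimple.
Local Open Scope classical_set_scope.
Local Open Scope ring_scope.

(** * Rearrangements and Schur's theorem *)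

(** Rearrangement bounds $\sum_k |a_k| b_k$ for each single $f$, with a bound depending on $f$.
    Baire category makes it uniform, and uniformity is what turns every bounded sequence $\theta$
    into a bounded functional $f \mapsto \sum_k \theta_k a_k b_k$ on $X$. Testing a weakly null
    sequence of $X$ against these functionals is exactly the weak convergence in $l^1$ that Schur's
    theorem requires. Elements of $X$ are functions, not classes modulo null functions, so [nrm] is
    only a seminorm and limits in $X$ need not be unique. The functional analysis is therefore done
    for complete seminormed subspaces of a module. Continuity of the coordinates is not presupposed:
    it is obtained in the same category argument, by bounding the partial sums of the expansion
    together with $\sum_k |a_k| b_k$. The constant 1 acts twice. As an element of $X$ it makes the
    functions representing functionals integrable; as an element of the Koethe dual it bounds
    $\int_E |f|$ by a multiple of the norm of $f$, which allows passing from partial sums to $r_n$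
    in $\int_E |r_n| \le \sum_k |a_k| b_k$. *)

Lemma cvgn_eps (R : realType) (w : nat -> R) (l : R) :
  w @ \oo --> l <->
  forall e, 0 < e -> exists N, forall n, (N <= n)%N -> `|w n - l| < e.
Proof.
split=> [/cvgrPdist_lt H e e0|H].
  by have [N _ HN] := H e e0; exists N => n Nn; rewrite distrC; exact: HN.
apply/cvgrPdist_lt => e e0; have [N HN] := H e e0.
by exists N => // n Nn; rewrite distrC; exact: HN.
Qed.

Lemma sum_ord_cat (R : nmodType) (F : nat -> R) p q : (p <= q)%N ->
  \sum_(k < q) F k = \sum_(k < p) F k + \sum_(p <= k < q) F k.
Proof.
by move=> pq; rewrite -!(big_mkord predT F) -big_cat_nat.
Qed.

Lemma sum_ord_nth (R : nmodType) (g : nat -> R) (s : nat -> nat) (l : seq nat) n :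
  (n <= size l)%N -> (forall k, (k < n)%N -> s k = nth 0%N l k) ->
  \sum_(k < n) g (s k) = \sum_(i <- take n l) g i.
Proof.
move=> nl sl.
rewrite (big_nth 0%N) size_take_min (minn_idPl nl) big_mkord.
by apply: eq_bigr => i _; rewrite sl// nth_take.
Qed.

(** Finite stages of a permutation of the naturals that preserves each block [[N j, N j.+1)] and
    lists its elements satisfying [P j] before the others. *)
Fixpoint block_list (N : nat -> nat) (P : nat -> pred nat) j : seq nat :=
  if j is j'.+1 then
    let b := index_iota (N j') (N j) in
    block_list N P j' ++ ([seq k <- b | P j' k] ++ [seq k <- b | ~~ P j' k])
  else [::].

Lemma block_list_perm N P j : N 0%N = 0%N -> (forall j, N j < N j.+1)%N ->
  perm_eq (block_list N P j) (iota 0 (N j)).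
Proof.
move=> N0 Nlt; elim: j => [|j IH]; first by rewrite N0.
have -> : iota 0 (N j.+1) = iota 0 (N j) ++ index_iota (N j) (N j.+1).
  by rewrite /index_iota -{2}(add0n (N j)) -iotaD subnKC// ltnW.
by apply: perm_cat => //; exact: (permEl (perm_filterC (P j) _)).
Qed.

Lemma block_list_prefix N P i j : (i <= j)%N ->
  prefix (block_list N P i) (block_list N P j).
Proof.
elim: j => [|j IH]; first by rewrite leqn0 => /eqP ->; exact: prefix_refl.
rewrite leq_eqVlt => /predU1P[->|]; first exact: prefix_refl.
rewrite ltnS => /IH/prefix_trans; apply.
exact: prefix_prefix.
Qed.

Lemma nth_prefix (l1 l2 : seq nat) k : prefix l1 l2 -> (k < size l1)%N ->
  nth 0%N l1 k = nth 0%N l2 k.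
Proof. by move=> /prefixP[t ->] kl; rewrite nth_cat kl. Qed.

(** The stages extend one another and each permutes an initial segment, so [nth] and [index] in any
    late enough stage define mutually inverse maps. The count [c] marks the partial sum that stops
    right after the selected elements of block [j]. *)
Lemma block_permutation (N : nat -> nat) (P : nat -> pred nat) :
  N 0%N = 0%N -> (forall j, N j < N j.+1)%N ->
  exists2 s : nat -> nat, bijective s &
    forall (R : nmodType) (g : nat -> R) j,
    let c := count (P j) (index_iota (N j) (N j.+1)) in
    \sum_(k < N j + c) g (s k) =
    \sum_(k < N j) g (s k) + \sum_(N j <= k < N j.+1 | P j k) g k.
Proof.
move=> N0 Nlt; pose L := block_list N P.
have Lperm j : perm_eq (L j) (iota 0 (N j)) by exact: block_list_perm.
have sL j : size (L j) = N j by rewrite (perm_size (Lperm j)) size_iota.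
have memL j k : (k \in L j) = (k < N j)%N.
  by rewrite (perm_mem (Lperm j)) mem_iota add0n.
have uL j : uniq (L j) by rewrite (perm_uniq (Lperm j)) iota_uniq.
have jN j : (j <= N j)%N.
  by elim: j => // j IH; exact: leq_ltn_trans IH (Nlt j).
have Lpre i j : (i <= j)%N -> prefix (L i) (L j) by exact: block_list_prefix.
have Lnth i j k : (k < N i)%N -> (k < N j)%N -> nth 0%N (L i) k = nth 0%N (L j) k.
  move=> ki kj; case/orP: (leq_total i j) => ij.
    by apply: nth_prefix; [exact: Lpre|rewrite sL].
  by apply/esym/nth_prefix; [exact: Lpre|rewrite sL].
have Lidx i j k : (k < N i)%N -> (k < N j)%N -> index k (L i) = index k (L j).
  wlog ij : i j / (i <= j)%N.
    by move=> W ki kj; case/orP: (leq_total i j) => ij; [|apply/esym]; apply: W.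
  move=> ki kj; have /prefixP[t ->] := Lpre _ _ ij.
  by rewrite index_cat memL ki.
pose s k := nth 0%N (L k.+1) k; pose t m := index m (L m.+1).
have sE j k : (k < N j)%N -> s k = nth 0%N (L j) k.
  by move=> kj; apply: Lnth => //; exact: jN.
have tE j k : (k < N j)%N -> t k = index k (L j).
  by move=> kj; apply: Lidx => //; exact: jN.
exists s.
  exists t => k.
  - have kN := jN k.+1.
    have skN : (s k < N k.+1)%N by rewrite -memL mem_nth// sL.
    by rewrite (tE _ _ skN) index_uniq// sL.
  - have kN := jN k.+1.
    have tkN : (t k < N k.+1)%N by rewrite -(sL k.+1) index_mem memL.
    by rewrite (sE _ _ tkN) nth_index// memL.
move=> R g j c.
have cN : (N j + c <= N j.+1)%N.
  have := count_size (P j) (index_iota (N j) (N j.+1)).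
  by rewrite size_iota -/c; have := Nlt j; lia.
rewrite (sum_ord_nth _ g s (L j.+1)) ?sL//; last first.
  by move=> k kc; apply: sE; exact: leq_trans kc cN.
rewrite (sum_ord_nth _ g s (L j)) ?sL//; last first.
  by move=> k kc; apply: sE.
rewrite [take (N j) _]take_oversize ?sL//.
have -> : L j.+1 = (L j ++ [seq k <- index_iota (N j) (N j.+1) | P j k]) ++
    [seq k <- index_iota (N j) (N j.+1) | ~~ P j k] by rewrite /L /= catA.
rewrite take_size_cat; first by rewrite big_cat big_filter.
by rewrite size_cat sL size_filter.
Qed.

Lemma unbounded_abs_block (R : realType) (x : nat -> R) :
  ~ (exists M, forall n, \sum_(k < n) `|x k| <= M) ->
  forall N, exists N', (N < N')%N /\ 2 <= \sum_(N <= k < N') `|x k|.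
Proof.
move=> nb N; apply: contrapT => /forallNP H; apply: nb.
exists (\sum_(k < N) `|x k| + 2) => n.
have mono p q : (p <= q)%N -> \sum_(k < p) `|x k| <= \sum_(k < q) `|x k|.
  by move=> pq; rewrite (sum_ord_cat _ (fun k => `|x k|) _ _ pq) lerDl sumr_ge0.
have [nN|Nn] := leqP n N; first by have := mono _ _ nN; lra.
have := H n; rewrite Nn => /not_andP[//|/negP]; rewrite -ltNge => lt2.
rewrite (sum_ord_cat _ (fun k => `|x k|) _ _ (ltnW Nn)).
by rewrite lerD2l ltW.
Qed.

(* A conditionally convergent series would have a divergent rearrangement: list, inside suitable consecutive blocks, the positive (or the negative) terms first. *)
Lemma rearrangements_cvg_bounded (R : realType) (x : nat -> R) :
  (forall s : nat -> nat, bijective s -> cvgn (fun n => \sum_(k < n) x (s k))) ->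
  exists M, forall n, \sum_(k < n) `|x k| <= M.
Proof.
move=> xs; apply: contrapT => /unbounded_abs_block H.
have [F FP] := choice H.
pose N j := iter j F 0%N.
(* The absolute values in a block sum to at least 2, so the positive terms or the remaining ones
   contribute at least 1; [P j] selects such a family. *)
pose P j : pred nat := if 1 <= \sum_(N j <= k < N j.+1 | 0 < x k) x k
  then fun k => 0 < x k else fun k => ~~ (0 < x k).
have Nlt j : (N j < N j.+1)%N by have [] := FP (N j).
have P1 j : 1 <= `|\sum_(N j <= k < N j.+1 | P j k) x k|.
  rewrite /P; case: ifPn => [le1|]; first exact: le_trans le1 (ler_norm _).
  rewrite -ltNge => lt1.
  have [_] := FP (N j); rewrite -/(N j.+1).
  rewrite (bigID (fun k => 0 < x k))/=.
  rewrite [X in X + _](_ : _ = \sum_(N j <= k < N j.+1 | 0 < x k) x k); last first.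
    by apply: eq_bigr => k k0; rewrite gtr0_norm.
  rewrite [X in _ + X](_ : _ = \sum_(N j <= k < N j.+1 | ~~ (0 < x k)) - x k); last first.
    by apply: eq_bigr => k; rewrite -leNgt => k0; rewrite ler0_norm.
  rewrite sumrN => le2; rewrite -normrN; apply: le_trans (ler_norm _); lra.
have [s bs sP] := block_permutation N P erefl Nlt.
(* Two partial sums within 1/2 of the limit differ by less than 1, against [P1]. *)
have /cvg_ex[l /cvgn_eps/(_ 2^-1)] := xs s bs.
rewrite invr_gt0 ltr0n => /(_ isT)[j Hj].
have jN : (j <= N j)%N.
  elim: (j) => // i IH; exact: leq_ltn_trans IH (Nlt i).
have h1 := Hj _ jN.
have h2 := Hj (N j + count (P j) (index_iota (N j) (N j.+1)))%N (leq_trans jN (leq_addr _ _)).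
rewrite sP in h2.
have := P1 j; apply/negP; rewrite -ltNge.
move: h1 h2; set a := \sum_(k < _) _; set b := \sum_(_ <= k < _ | _) _ => h1 h2.
have -> : b = (a + b - l) - (a - l) by lra.
by apply: le_lt_trans (ler_normB _ _) _; lra.
Qed.

(* Schur's theorem, by a gliding hump. *)
Lemma schur_l1 (R : realType) (x : nat -> nat -> R) :
  (forall n, exists M, forall m, \sum_(k < m) `|x n k| <= M) ->
  (forall th : nat -> R, (forall k, `|th k| <= 1) -> forall e, 0 < e ->
     exists n0, forall n, (n0 <= n)%N ->
     exists m0, forall m, (m0 <= m)%N -> `|\sum_(k < m) th k * x n k| < e) ->
  forall e, 0 < e -> exists n, forall m, \sum_(k < m) `|x n k| < e.
Proof.
move=> bx wx e e0; apply: contrapT => /forallNP H.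
have {}H n : exists m, e <= \sum_(k < m) `|x n k|.
  by have /existsNP[m /negP] := H n; rewrite -leNgt => ?; exists m.
have mono n p q : (p <= q)%N -> \sum_(k < p) `|x n k| <= \sum_(k < q) `|x n k|.
  move=> pq; rewrite (sum_ord_cat _ (fun k => `|x n k|) _ _ pq).
  by rewrite lerDl sumr_ge0.
(* Testing against the [k]-th unit sequence shows that each column tends to 0. *)
have col k d : 0 < d -> exists n0, forall n, (n0 <= n)%N -> `|x n k| < d.
  move=> d0; have [|n0 Hn0] := wx (fun i => (i == k)%:R) _ d d0.
    by move=> i; case: eqP => _; rewrite ?normr1 ?normr0.
  exists n0 => n /Hn0[m0 /(_ (m0 + k.+1)%N (leq_addr _ _))].
  have km : (k < m0 + k.+1)%N by lia.
  rewrite (bigD1 (Ordinal km))//= eqxx mul1r big1 ?addr0// => i.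
  by rewrite -val_eqE/= => /negPf ->; rewrite mul0r.
have cols K d : 0 < d ->
    exists n0, forall n, (n0 <= n)%N -> \sum_(k < K) `|x n k| < d.
  elim: K d => [|K IH] d d0; first by exists 0%N => n _; rewrite big_ord0.
  have d2 : 0 < d / 2 by lra.
  have [n1 h1] := IH _ d2; have [n2 h2] := col K _ d2.
  exists (maxn n1 n2) => n; rewrite geq_max => /andP[/h1 h /h2 h'].
  by rewrite big_ord_recr/=; lra.
have tail n d : 0 < d -> exists K, forall m, (K <= m)%N ->
    \sum_(K <= k < m) `|x n k| <= d.
  move=> d0; have [M hM] := bx n.
  pose S := range (fun m => \sum_(k < m) `|x n k|).
  have hS : has_sup S.
    by split; [exists (\sum_(k < 0) `|x n k|), 0%N|exists M => _ [m _ <-]].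
  have [_ [K _ <-] hK] := sup_adherent d0 hS.
  exists K => m Km.
  have : \sum_(k < m) `|x n k| <= sup S by apply: ub_le_sup; [case: hS|exists m].
  by rewrite (sum_ord_cat _ (fun k => `|x n k|) _ _ Km); lra.
have e8 : 0 < e / 8 by lra.
(* A state is a row together with a cutoff. The next row is chosen late enough to be small before
   the old cutoff, and the new cutoff far enough to leave a small tail, so nearly all the mass of
   that row sits between the two cutoffs. *)
have step (p : nat * nat) : exists q : nat * nat,
    [/\ (p.1 < q.1)%N, (p.2 < q.2)%N, \sum_(k < p.2) `|x q.1 k| < e / 8,
      e <= \sum_(k < q.2) `|x q.1 k| &
      forall m, (q.2 <= m)%N -> \sum_(q.2 <= k < m) `|x q.1 k| <= e / 8].
  have [n0 h0] := cols p.2 _ e8.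
  pose n := maxn n0 p.1.+1.
  have [m hm] := H n; have [K hK] := tail n _ e8.
  pose K' := maxn K (maxn m p.2.+1).
  exists (n, K'); split => /=.
  - by rewrite /n; lia.
  - by rewrite /K'; lia.
  - by apply: h0; rewrite /n; lia.
  - by apply: le_trans hm _; apply: mono; rewrite /K'; lia.
  - move=> m' Km'; have KK : (K <= K')%N by rewrite /K'; lia.
    apply: le_trans (hK m' (leq_trans KK Km')).
    rewrite -(lerD2l (\sum_(k < K) `|x n k|)).
    rewrite -(sum_ord_cat _ (fun k => `|x n k|) _ _ (leq_trans KK Km')).
    rewrite (sum_ord_cat _ (fun k => `|x n k|) _ _ Km') lerD2r.
    exact: mono.
have [F FP] := choice step.
pose p j := iter j F (0%N, 0%N).
have pP j := FP (p j).
have pS j : F (p j) = p j.+1 by [].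
have K0 : (p 0%N).2 = 0%N by [].
have Kmono : {homo (fun j => (p j).2) : i j / (i <= j)%N}.
  apply: homo_leq; [exact: leqnn|exact: leq_trans|].
  by move=> j; have [_ /ltnW] := pP j.
have jK j : (j <= (p j).2)%N.
  elim: j => // j IH; have [_ h _ _ _] := pP j; exact: leq_ltn_trans IH h.
have jn j : (j <= (p j).1)%N.
  elim: j => // j IH; have [h _ _ _ _] := pP j; exact: leq_ltn_trans IH h.
have exJ k : exists j, (k < (p j.+1).2)%N by exists k; exact: jK.
pose J k := ex_minn (exJ k).
have JE j k : ((p j).2 <= k < (p j.+1).2)%N -> J k = j.
  move=> /andP[h1 h2]; rewrite /J; case: ex_minnP => i h3 h4.
  apply/eqP; rewrite eqn_leq h4//= leqNgt; apply/negP => ij.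
  have := leq_trans h3 (Kmono _ _ ij); lia.
(* [J k] is the block containing [k]; there the test sequence copies the signs of the row whose hump
   occupies that block. *)
pose th k := Num.sg (x (p (J k).+1).1 k).
have th1 k : `|th k| <= 1.
  by rewrite /th normr_sg; case: (x _ _ != 0); rewrite ?lexx ?ler01.
(* The hump exceeds 7e/8, while head and tail subtract at most e/8 each, so the tested sum stays
   above e/4. *)
have [n0 h0] := wx th th1 (e / 4) ltac:(lra).
pose j := n0; pose n := (p j.+1).1.
have nn : (n0 <= n)%N by have := jn j.+1; rewrite /n /j; lia.
have [m0 hm0] := h0 n nn.
pose m := maxn m0 (p j.+1).2.
have := hm0 m (leq_maxl _ _); apply/negP; rewrite -leNgt.
have [h1 h2 h3 h4 h5] := pP j; rewrite pS -/n in h1 h2 h3 h4 h5.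
have Km : ((p j.+1).2 <= m)%N by rewrite /m; lia.
have thb (k : nat) : `|th k * x n k| <= `|x n k|.
  by rewrite normrM ler_piMl.
have b1 : `|\sum_(k < (p j).2) th k * x n k| < e / 8.
  by apply: le_lt_trans h3; apply: le_trans (ler_norm_sum _ _ _) _; apply: ler_sum.
have b3 : `|\sum_((p j.+1).2 <= k < m) th k * x n k| <= e / 8.
  apply: le_trans (h5 m Km); apply: le_trans (ler_norm_sum _ _ _) _.
  by apply: ler_sum.
have b2 : \sum_((p j).2 <= k < (p j.+1).2) th k * x n k =
          \sum_((p j).2 <= k < (p j.+1).2) `|x n k|.
  apply: eq_big_nat => k /JE jk; rewrite /th jk -/n.
  by rewrite [RHS]normrEsg.
move: h4; rewrite (sum_ord_cat _ (fun k => `|x n k|) _ _ (ltnW h2)) -b2.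
rewrite (sum_ord_cat _ (fun k => th k * x n k) _ _ Km).
rewrite (sum_ord_cat _ (fun k => th k * x n k) _ _ (ltnW h2)).
move: b1 b3; rewrite ltr_norml ler_norml => /andP[b1 _] /andP[b3 _] h4.
apply: le_trans (ler_norm _); lra.
Qed.

(** * Zabreiko's lemma *)

Lemma cvgn_geo_half (R : realType) (c : R) : (fun n => c / 2 ^+ n) @ \oo --> (0 : R).
Proof.
rewrite -[X in _ --> X](mulr0 c); apply: cvgM; first exact: cvg_cst.
under eq_fun do rewrite -exprVn.
by apply: cvg_expr; rewrite ger0_norm ?invr_ge0// invf_lt1// ltr1n.
Qed.

(** Separation is deliberately absent, to fit functions that are not identified almost everywhere: a
    Cauchy sequence has some limit in [X], not a unique one. *)
Definition seminormed_subspace (R : realType) (V : lmodType R) (X : set V)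
    (N : V -> R) : Prop :=
  [/\ [/\ X 0, (forall f g, X f -> X g -> X (f + g)) &
          (forall c f, X f -> X (c *: f))],
      (forall f, X f -> 0 <= N f),
      (forall f g, X f -> X g -> N (f + g) <= N f + N g),
      (forall c f, X f -> N (c *: f) = `|c| * N f) &
      (forall g : nat -> V, (forall n, X (g n)) ->
         (forall e : R, 0 < e -> exists M, forall m n, (M <= m)%N -> (M <= n)%N ->
            N (g m - g n) < e) ->
         exists f, X f /\ (fun n => N (g n - f)) @ \oo --> (0 : R))].

Lemma seminormed_subspaceP (R : realType) (V : lmodType R) (X : set V) (N : V -> R) :
  seminormed_subspace R V X N ->
  [/\ (forall f, X f -> X (- f)), (forall f g, X f -> X g -> X (f - g)),
      N 0 = 0, (forall f, X f -> N (- f) = N f) &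
      (forall f g, X f -> X g -> N (f - g) <= N f + N g)].
Proof.
move=> [[X0 XD XZ] N0 ND NZ _].
have XN f : X f -> X (- f) by move=> Xf; rewrite -scaleN1r; exact: XZ.
have NN f : X f -> N (- f) = N f.
  by move=> Xf; rewrite -scaleN1r NZ// normrN1 mul1r.
split => //.
- by move=> f g Xf Xg; exact/XD/XN.
- by rewrite -(scale0r 0) NZ// normr0 mul0r.
- by move=> f g Xf Xg; rewrite -(NN g)//; exact/ND/XN.
Qed.

(* Baire category theorem, without assuming the sets [A n] closed. *)
Lemma exists_nowhere_avoided (R : realType) (V : lmodType R) (X : set V)
    (N : V -> R) (A : nat -> set V) :
  seminormed_subspace R V X N -> (forall x, X x -> exists n, A n x) ->
  exists n x0 r, [/\ X x0, 0 < r & forall y, X y -> N (y - x0) < r ->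
    forall e, 0 < e -> exists z, [/\ X z, A n z & N (y - z) < e]].
Proof.
move=> XN cov; have [XN' XB N00 NN NB] := seminormed_subspaceP _ _ _ _ XN.
have [[X0 XD XZ] N0 ND NZ Ncomp] := XN.
have NBC x y : X x -> X y -> N (x - y) = N (y - x).
  by move=> Xx Xy; rewrite -NN ?opprB//; exact: XB.
apply: contrapT => H.
(* Failure of density in the ball of radius r/2 yields a centre [y] at distance at least some [e]
   from [A n]. The radius min(r/2, e/2) nests the closed balls and keeps the new one off [A n].
   Other inputs get an arbitrary value because [choice] needs a total step. *)
have step (p : nat * (V * R)) : exists q : V * R,
    X p.2.1 -> 0 < p.2.2 ->
    [/\ X q.1, 0 < q.2, N (q.1 - p.2.1) <= p.2.2 - q.2, q.2 <= p.2.2 / 2 &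
     forall z, X z -> A p.1 z -> q.2 < N (q.1 - z)].
  case: p => n [x r] /=.
  have [[Xx r0]|] := pselect (X x /\ 0 < r); last first.
    by move=> nXr; exists (x, r) => Xx r0; case: nXr.
  move: H => /forallNP/(_ n)/forallNP/(_ x)/forallNP/(_ (r / 2)) H.
  have {H} [y [Xy yr [e e0 He]]] : exists y, [/\ X y, N (y - x) < r / 2 &
      exists2 e, 0 < e & forall z, X z -> A n z -> e <= N (y - z)].
    apply: contrapT => nH; apply: H; split => //; first by lra.
    move=> y Xy yr e e0; apply: contrapT => nz; apply: nH; exists y; split=> //.
    exists e => // z Xz Az; rewrite leNgt; apply/negP => yz.
    by apply: nz; exists z.
  exists (y, Num.min (r / 2) (e / 2)) => _ _ /=.
  have m1 : Num.min (r / 2) (e / 2) <= r / 2 by rewrite ge_min lexx.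
  have m2 : Num.min (r / 2) (e / 2) <= e / 2 by rewrite ge_min lexx orbT.
  split => //; first by rewrite lt_min; lra.
  - by lra.
  - by move=> z Xz Az; have := He z Xz Az; lra.
have [F FP] := choice step.
pose p := fix p n := if n is n'.+1 then F (n', p n') else (0, 1) : V * R.
have pX n : X (p n).1 /\ 0 < (p n).2.
  elim: n => [|n [h1 h2]] /=; first by split => //; exact: ltr01.
  by have [] := FP (n, p n) h1 h2.
have pP n := FP (n, p n) (pX n).1 (pX n).2.
have pS n : F (n, p n) = p n.+1 by [].
have dist m n : (n <= m)%N -> N ((p m).1 - (p n).1) <= (p n).2 - (p m).2.
  elim: m => [|m IH]; first by rewrite leqn0 => /eqP ->; rewrite !subrr N00.
  rewrite leq_eqVlt => /predU1P[->|]; first by rewrite !subrr N00.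
  rewrite ltnS => /IH {}IH.
  have [h1 h2 h3 h4 h5] := pP m; rewrite pS/= in h1 h2 h3 h4 h5.
  rewrite -(subrKA (p m).1); apply: le_trans (ND _ _ _ _) _.
  - by apply: (XB); [|have [] := pX m].
  - by apply: (XB); [have [] := pX m|have [] := pX n].
  - by lra.
have rgeo n : (p n).2 <= 1 / 2 ^+ n.
  elim: n => [|n IH]; first by rewrite expr0 divr1.
  have [_ _ _ h4 _] := pP n; rewrite pS/= in h4.
  apply: le_trans h4 _; rewrite exprSr invfM mulrA.
  by rewrite ler_pM2r ?invr_gt0.
have [|x [Xx xlim]] := Ncomp (fun n => (p n).1) (fun n => (pX n).1).
  move=> e e0; have /cvgn_eps/(_ (e / 2)) [|M HM] := cvgn_geo_half R 1; first by lra.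
  have rM : (p M).2 < e / 2.
    have := HM M (leqnn _); rewrite subr0 ger0_norm ?divr_ge0 ?exprn_ge0//.
    by apply: le_lt_trans; exact: rgeo.
  exists M => m n Mm Mn.
  rewrite -(subrKA (p M).1); apply: le_lt_trans (ND _ _ _ _) _.
  - by apply: (XB); [have [] := pX m|have [] := pX M].
  - by apply: (XB); [have [] := pX M|have [] := pX n].
  - rewrite (NBC _ _ (pX M).1 (pX n).1).
    have := dist _ _ Mm; have := dist _ _ Mn.
    by have [_] := pX m; have [_] := pX n; lra.
have [n An] := cov x Xx.
have [h1 h2 h3 h4 h5] := pP n; rewrite pS/= in h1 h2 h3 h4 h5.
have hx := h5 x Xx An.
(* The limit of the centres lies in every closed ball, in particular in the one that avoids
   [A n]. *)
have : N ((p n.+1).1 - x) <= (p n.+1).2; last by lra.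
apply/ler_addgt0Pr => e e0.
have /cvgn_eps/(_ e e0)[M HM] := xlim.
pose m := maxn M n.+1.
rewrite -(subrKA (p m).1); apply: le_trans (ND _ _ _ _) _.
- by apply: (XB); [|have [] := pX m].
- by apply: (XB); [have [] := pX m|].
rewrite (NBC _ _ (pX n.+1).1 (pX m).1).
have := dist m n.+1 (leq_maxr _ _); have [_ ?] := pX m.
have := HM m (leq_maxl _ _); rewrite subr0 ger0_norm; first by lra.
by apply/N0/XB => //; exact: (pX _).1.
Qed.

(* Zabreiko's lemma, for the seminorm whose sublevel sets are [B c]. *)
Lemma zabreiko (R : realType) (V : lmodType R) (X : set V) (N : V -> R)
    (B : R -> set V) :
  seminormed_subspace R V X N ->
  (forall x, X x -> exists c, B c x) ->
  (forall c c' x, c <= c' -> B c x -> B c' x) ->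
  (forall c c' x y, X x -> X y -> B c x -> B c' y -> B (c + c') (x + y)) ->
  (forall c t x, X x -> B c x -> B (`|t| * c) (t *: x)) ->
  (forall (y : nat -> V) x c, X x -> (forall n, X (y n)) -> y 0%N = 0 ->
     (fun n => N (x - y n)) @ \oo --> (0 : R) ->
     (forall I M, (I <= M)%N -> B (c / 2 ^+ I) (y M - y I)) -> B c x) ->
  exists2 C, 0 <= C & forall x t, X x -> N x < t -> B (C * t) x.
Proof.
move=> XN cov Bmono BD BZ Bcl.
have [XN' XB N00 NN NB] := seminormed_subspaceP _ _ _ _ XN.
have [[X0 XD XZ] N0 ND NZ Ncomp] := XN.
have [x Xx|n [x0 [r [Xx0 r0 near]]]] :=
    exists_nowhere_avoided R V X N (fun n => B n%:R) XN.
  have [c Bc] := cov x Xx; exists (Num.truncn c).+1.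
  apply: Bmono Bc; apply/ltW; exact: truncnS_gt.
(* Near $x_0$ and near $x_0 + (r/t)y$ there are elements of [B n]; their difference lies in [B (2n)]
   and, rescaled by $t/r$, approximates [y] inside [B (K t)]. *)
pose K : R := n%:R * 2 / r.
have K0 : 0 <= K by rewrite divr_ge0 ?mulr_ge0// ltW.
have appr y t e : X y -> N y < t -> 0 < e ->
    exists z, [/\ X z, B (K * t) z & N (y - z) < e].
  move=> Xy yt e0.
  have t0 : 0 < t by apply: le_lt_trans yt; exact: N0.
  have s0 : 0 < r / t by rewrite divr_gt0.
  have Xs : X ((r / t) *: y) by exact: XZ.
  have e2 : 0 < e * (r / t) / 2 by rewrite !(divr_gt0, mulr_gt0).
  have [||z1 [Xz1 Bz1 h1]] := near (x0 + (r / t) *: y) _ _ _ e2.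
  - exact: XD.
  - rewrite addrC addKr NZ// gtr0_norm//.
    by rewrite mulrAC ltr_pdivrMr// ltr_pM2l.
  have [|z2 [Xz2 Bz2 h2]] := near x0 Xx0 _ _ e2; first by rewrite subrr N00.
  exists ((t / r) *: (z1 - z2)).
  have ts : (t / r) * (r / t) = 1 by rewrite mulrA divfK ?divff ?gt_eqF.
  have tr0 : 0 < t / r by rewrite divr_gt0.
  split.
  - by apply: XZ; exact: XB.
  - have -> : K * t = `|t / r| * (n%:R + `|-1| * n%:R).
      by rewrite normrN1 gtr0_norm// /K; lra.
    apply: (BZ); first exact: XB.
    apply: (BD) => //; first exact: XN'.
    by rewrite -scaleN1r; exact: BZ.
  - have -> : y - (t / r) *: (z1 - z2) =
        (t / r) *: ((x0 + (r / t) *: y - z1) - (x0 - z2)).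
      have -> (a b c f : V) : (a + b - c) - (a - f) = b - (c - f).
        rewrite [a + b]addrC -[b + a - c]addrA -addrA; congr (_ + _).
        by rewrite !opprB addrC subrKA.
      by rewrite [RHS]scalerBr !scalerA ts scale1r.
    rewrite NZ; last by apply: (XB); apply: (XB) => //; exact: XD.
    rewrite gtr0_norm//.
    apply: (@lt_le_trans _ _ ((t / r) * (e * (r / t)))).
      rewrite ltr_pM2l//; apply: le_lt_trans (NB _ _ _ _) _.
      - by apply: (XB) => //; exact: XD.
      - exact: XB.
      - by lra.
    by rewrite mulrCA ts mulr1.
exists (2 * K); first by rewrite mulr_ge0.
move=> x t Xx xt.
have t0 : 0 < t by apply: le_lt_trans xt; exact: N0.
have g0 i : 0 < t / 2 ^+ i by rewrite divr_gt0 ?exprn_gt0.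
have step (p : nat * V) : exists z, X p.2 -> N p.2 < t / 2 ^+ p.1 ->
    [/\ X z, B (K * (t / 2 ^+ p.1)) z & N (p.2 - z) < t / 2 ^+ p.1.+1].
  case: p => i y /=; have [[Xy yt]|] := pselect (X y /\ N y < t / 2 ^+ i).
    by have [z] := appr y _ _ Xy yt (g0 i.+1); exists z.
  by move=> nH; exists 0 => ? ?; case: nH.
have [F FP] := choice step.
(* Successive remainders: subtracting an approximant halves the norm bound each time, so the partial
   sums [x - w i] converge to [x]. *)
pose w := fix w i := if i is j.+1 then w j - F (j, w j) else x : V.
have wP i : X (w i) /\ N (w i) < t / 2 ^+ i.
  elim: i => [|i [h1 h2]] /=; first by rewrite expr0 divr1.
  by have [h3 h4 h5] := FP (i, w i) h1 h2; split => //; exact: XB.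
apply: (Bcl (fun i => x - w i)) => //.
- by move=> i; apply: (XB) => //; exact: (wP i).1.
- by rewrite subrr.
- apply/cvgn_eps => e e0.
  have /cvgn_eps/(_ e e0)[M HM] := cvgn_geo_half R t.
  exists M => i /HM; rewrite !subr0 opprB addrC subrK.
  rewrite (ger0_norm (ltW (g0 i))) (ger0_norm (N0 _ (wP i).1)).
  exact/lt_trans/(wP i).2.
- move=> I M IM.
  rewrite opprB addrC addrA subrK.
  (* The exact value of the geometric sum $\sum_{I \le i < M} K t/2^i$ is kept so that the induction
     on [M] closes. *)
  suff : B (2 * K * t * ((2 ^+ I)^-1 - (2 ^+ M)^-1)) (w I - w M).
    apply: (Bmono); apply: ler_wpM2l.
      by apply: mulr_ge0; [exact: mulr_ge0|exact: ltW].
    by rewrite gerBl invr_ge0 exprn_ge0.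
  elim: M IM => [|M IH].
    rewrite leqn0 => /eqP ->; rewrite !subrr mulr0.
    have [c Bc] := cov _ X0; have := BZ c 0 0 X0 Bc.
    by rewrite normr0 mul0r scaler0.
  rewrite leq_eqVlt => /predU1P[->|].
    rewrite !subrr mulr0.
    have [c Bc] := cov _ X0; have := BZ c 0 0 X0 Bc.
    by rewrite normr0 mul0r scaler0.
  rewrite ltnS => /IH {}IH /=.
  have [h1 h2 h3] := FP (M, w M) (wP M).1 (wP M).2.
  have -> : w I - (w M - F (M, w M)) = (w I - w M) + F (M, w M).
    by rewrite opprB addrA addrAC.
  have -> : 2 * K * t * ((2 ^+ I)^-1 - (2 ^+ M.+1)^-1) =
      2 * K * t * ((2 ^+ I)^-1 - (2 ^+ M)^-1) + K * (t / 2 ^+ M).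
    rewrite exprSr invfM.
    by set a := (2 ^+ I)^-1; set b := (2 ^+ M)^-1; lra.
  by apply: (BD) => //; apply: (XB); exact: (wP _).1.
Qed.

(** * Halving sets in atomless measure spaces *)

Lemma mu_fin_num (d : measure_display) (T : measurableType d) (R : realType)
    (mu : {measure set T -> \bar R}) (A : set T) :
  (mu setT < +oo)%E -> measurable A -> mu A \is a fin_num.
Proof.
move=> fin mA; rewrite ge0_fin_numE//; apply: le_lt_trans fin.
by apply: le_measure; rewrite ?inE.
Qed.

Lemma fine_measureD (d : measure_display) (T : measurableType d) (R : realType)
    (mu : {measure set T -> \bar R}) (A B : set T) :
  (mu setT < +oo)%E -> measurable A -> measurable B ->
  fine (mu A) = fine (mu (A `\` B)) + fine (mu (A `&` B)).
Proof.
move=> fin mA mB; rewrite (measureDI _ mA mB)//.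
rewrite fineD//; apply: mu_fin_num => //; [exact: measurableD|exact: measurableI].
Qed.

Lemma fine_measure_le (d : measure_display) (T : measurableType d) (R : realType)
    (mu : {measure set T -> \bar R}) (A B : set T) :
  (mu setT < +oo)%E -> measurable A -> measurable B -> A `<=` B ->
  fine (mu A) <= fine (mu B).
Proof.
move=> fin mA mB AB; rewrite fine_le ?mu_fin_num//.
by apply: le_measure; rewrite ?inE.
Qed.

Lemma fine_measure_gt0 (d : measure_display) (T : measurableType d) (R : realType)
    (mu : {measure set T -> \bar R}) (A : set T) :
  (mu setT < +oo)%E -> measurable A -> (0 < mu A)%E = (0 < fine (mu A)).
Proof.
by move=> fin mA; rewrite -lte_fin fineK// mu_fin_num.
Qed.

(** Of a proper part of positive measure and its complement, one has at most half the measure;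
    iterating gives geometric decay. *)
Lemma atomless_small (d : measure_display) (T : measurableType d) (R : realType)
    (mu : {measure set T -> \bar R}) (A : set T) (e : R) :
  atomless mu -> (mu setT < +oo)%E -> measurable A -> 0 < fine (mu A) -> 0 < e ->
  exists B, [/\ measurable B, B `<=` A, 0 < fine (mu B) & fine (mu B) < e].
Proof.
move=> al fin mA A0 e0.
have half B : measurable B -> 0 < fine (mu B) -> exists C,
    [/\ measurable C, C `<=` B, 0 < fine (mu C) & fine (mu C) <= fine (mu B) / 2].
  move=> mB B0; have [|C [mC CB C0 CltB]] := al B mB; first by rewrite fine_measure_gt0.
  have C0' : 0 < fine (mu C) by rewrite -fine_measure_gt0.
  have CB' : fine (mu C) < fine (mu B) by rewrite -lte_fin !fineK ?mu_fin_num.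
  have := fine_measureD _ _ _ mu B C fin mB mC; rewrite (setIidr CB) => BE.
  have [h|h] := leP (fine (mu C)) (fine (mu B) / 2); first by exists C.
  by exists (B `\` C); split; [exact: measurableD|exact: subDsetl|lra|lra].
have iter n : exists B, [/\ measurable B, B `<=` A, 0 < fine (mu B) &
    fine (mu B) <= fine (mu A) / 2 ^+ n].
  elim: n => [|n [B [mB BA B0 Bn]]].
    by exists A; split => //; rewrite expr0 divr1.
  have [C [mC CB C0 Cle]] := half B mB B0; exists C; split => //.
    exact: subset_trans BA.
  apply: le_trans Cle _; rewrite exprSr invfM mulrA.
  by rewrite ler_pM2r ?invr_gt0.
have /cvgn_eps/(_ e e0)[n Hn] := cvgn_geo_half R (fine (mu A)).
have [B [mB BA B0 Bn]] := iter n; exists B; split => //.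
apply: le_lt_trans Bn _.
have := Hn n (leqnn _); rewrite subr0 ger0_norm// divr_ge0 ?exprn_ge0//.
Qed.

(* Sierpinski's theorem, by greedy exhaustion. *)
Lemma sierpinski (d : measure_display) (T : measurableType d) (R : realType)
    (mu : {measure set T -> \bar R}) (A : set T) (t : R) :
  atomless mu -> (mu setT < +oo)%E -> measurable A -> 0 <= t <= fine (mu A) ->
  exists B, [/\ measurable B, B `<=` A & fine (mu B) = t].
Proof.
move=> al fin mA /andP[t0 tA].
pose adm B C := [/\ measurable C, C `<=` A `\` B & fine (mu B) + fine (mu C) <= t].
pose ok B := [/\ measurable B, B `<=` A & fine (mu B) <= t].
(* Greedy choice: [C] realizes at least half of the supremum of the measures that can still be added
   without exceeding [t]. *)
have step B : exists C, ok B -> adm B C /\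
    forall D, adm B D -> fine (mu D) <= 2 * fine (mu C).
  have [okB|] := pselect (ok B); last by exists set0.
  have [mB BA Bt] := okB.
  pose S := [set fine (mu C) | C in adm B].
  have adm0 : adm B set0 by split; [exact: measurable0|exact: sub0set|rewrite measure0/= addr0].
  have hS : has_sup S.
    split; first by exists (fine (mu set0)), set0.
    by exists t => _ [C [mC _ h] <-]; have := fine_ge0 (measure_ge0 mu B); lra.
  have Sle D : adm B D -> fine (mu D) <= sup S.
    by move=> aD; apply: ub_le_sup; [case: hS|exists D].
  have [s0|s0] := ltP 0 (sup S); last first.
    exists set0 => _; split => // D /Sle; rewrite measure0/=; lra.
  have s2 : 0 < sup S / 2 by lra.
  have [_ [C aC <-] hC] := sup_adherent s2 hS.
  exists C => _; split => // D /Sle; lra.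
have [F FP] := choice step.
pose Bs := fix Bs n := if n is m.+1 then Bs m `|` F (Bs m) else set0 : set T.
have BsU n : ok (Bs n) -> fine (mu (Bs n.+1)) = fine (mu (Bs n)) + fine (mu (F (Bs n))).
  move=> okB; have [mB _ _] := okB; have [[mF FA _] _] := FP _ okB.
  rewrite /= measureU ?fineD ?mu_fin_num//.
  by rewrite -subset0 => x [Bx /FA[_]].
have okBs n : ok (Bs n).
  elim: n => [|n IH]; first by split; [exact: measurable0|exact: sub0set|rewrite measure0].
  have := BsU n IH; have [mB BA Bt] := IH; have [[mF FA Ft] _] := FP _ IH.
  move=> E; split; [exact: (measurableU _ _ mB mF)| |by rewrite E].
  by move=> x [/BA//|/FA[]].
have mBs n : measurable (Bs n) by have [] := okBs n.
pose B := \bigcup_n Bs n.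
have mB : measurable B by exact: bigcup_measurable.
have BA : B `<=` A by move=> x [n _]; have [_ + _] := okBs n; apply.
have sub n : Bs n `<=` B by move=> x Bx; exists n.
have Bt : fine (mu B) <= t.
  have nd : nondecreasing_seq Bs.
    by apply/nondecreasing_seqP => n; apply/subsetPset => x; left.
  have /fine_cvgP[_ cv] : mu \o Bs @ \oo --> (fine (mu B))%:E.
    by rewrite fineK ?mu_fin_num//; exact: nondecreasing_cvg_mu.
  apply: (cvgr_to_le cv); near=> n.
  by have [_ _] := okBs n.
exists B; split => //; apply/eqP; rewrite eq_le Bt/= leNgt; apply/negP => Blt.
have AB := fine_measureD _ _ _ mu A B fin mA mB; rewrite (setIidr BA) in AB.
have [||D [mD DAB D0 Dlt]] :=
    atomless_small _ _ _ mu (A `\` B) (t - fine (mu B)) al fin (measurableD mA mB).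
- lra.
- lra.
have admD n : adm (Bs n) D.
  split => //; first by move=> x /DAB[Ax nB]; split => // /sub.
  have := fine_measure_le _ _ _ mu _ _ fin (mBs n) mB (sub n); lra.
(* If the union fell short of [t], the fixed small set [D] would stay admissible forever, so every
   greedy step would add at least half of its measure, eventually exceeding [t]. *)
have grow n : n%:R * (fine (mu D) / 2) <= fine (mu (Bs n)).
  elim: n => [|n IH]; first by rewrite mul0r measure0.
  rewrite (BsU n (okBs n)).
  have [_ /(_ D (admD n)) h] := FP _ (okBs n).
  by rewrite -natr1 mulrDl mul1r; lra.
have D2 : 0 < fine (mu D) / 2 by lra.
have := grow (Num.truncn (t / (fine (mu D) / 2))).+1.
have [_ _ h] := okBs (Num.truncn (t / (fine (mu D) / 2))).+1.
move=> h'; have := le_trans h' h.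
rewrite -ler_pdivlMr// leNgt => /negP; apply.
exact: truncnS_gt.
Unshelve. all: by end_near.
Qed.

(** Induction on the list with [E] varying: the parts of [E] inside and outside the head [A] are
    halved separately, and the union of the two halves still halves every remaining set. *)
Lemma halving_sets (d : measure_display) (T : measurableType d) (R : realType)
    (mu : {measure set T -> \bar R}) (s : seq (set T)) (E : set T) :
  atomless mu -> (mu setT < +oo)%E -> measurable E ->
  (forall A, List.In A s -> measurable A) ->
  exists B, [/\ measurable B, B `<=` E, fine (mu B) = fine (mu E) / 2 &
    forall A, List.In A s -> fine (mu (B `&` A)) = fine (mu (E `&` A)) / 2].
Proof.
move=> al fin; elim: s E => [|A s IH] E mE ms.
  have [|B [mB BE Bh]] := sierpinski _ _ _ mu E (fine (mu E) / 2) al fin mE.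
    have := fine_ge0 (measure_ge0 mu E); lra.
  by exists B.
have mA : measurable A by apply: ms; left.
have ms' C : List.In C s -> measurable C by move=> Cs; apply: ms; right.
have [B1 [mB1 B1E h1 k1]] := IH (E `&` A) (measurableI _ _ mE mA) ms'.
have [B2 [mB2 B2E h2 k2]] := IH (E `\` A) (measurableD mE mA) ms'.
have add C : measurable C ->
    fine (mu ((B1 `|` B2) `&` C)) = fine (mu (B1 `&` C)) + fine (mu (B2 `&` C)).
  move=> mC; rewrite setIUl measureU; [|exact: measurableI|exact: measurableI|].
    by rewrite fineD ?mu_fin_num//; exact: measurableI.
  by rewrite -subset0 => x [[/B1E[_ Ax] _] [/B2E[_ nAx] _]].
exists (B1 `|` B2); split.
- exact: measurableU.
- by move=> x [/B1E[]|/B2E[]].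
- rewrite -[in LHS](setIT (_ `|` _)) add// !setIT h1 h2.
  by rewrite (fine_measureD _ _ _ mu E A fin mE mA); lra.
- move=> C [<-|Cs].
    rewrite add//.
    rewrite (setIidl (_ : B1 `<=` A)); last by move=> x /B1E[].
    rewrite (_ : B2 `&` A = set0) ?measure0 ?addr0//.
    by rewrite -subset0 => x [/B2E[_]].
  have mC := ms' _ Cs.
  rewrite add// k1// k2//.
  rewrite (fine_measureD _ _ _ mu (E `&` C) A fin (measurableI _ _ mE mC) mA).
  rewrite setIAC (_ : (E `&` C) `\` A = (E `\` A) `&` C); last first.
    by apply/seteqP; split => x /=; tauto.
  lra.
Qed.

(* The sets where the Rademacher functions of [E] take the value 1. *)
Lemma rademacher_sets (d : measure_display) (T : measurableType d) (R : realType)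
    (mu : {measure set T -> \bar R}) (E : set T) :
  atomless mu -> (mu setT < +oo)%E -> measurable E ->
  exists B : nat -> set T, forall n, [/\ measurable (B n), B n `<=` E,
    fine (mu (B n)) = fine (mu E) / 2 &
    forall m, (m < n)%N -> fine (mu (B n `&` B m)) = fine (mu E) / 4].
Proof.
move=> al fin mE.
have step (s : seq (set T)) : exists B, (forall A, List.In A s -> measurable A) ->
   [/\ measurable B, B `<=` E, fine (mu B) = fine (mu E) / 2 &
    forall A, List.In A s -> fine (mu (B `&` A)) = fine (mu (E `&` A)) / 2].
  have [ms|] := pselect (forall A, List.In A s -> measurable A); last by exists set0.
  by have [B HB] := halving_sets _ _ _ mu s E al fin mE ms; exists B.
have [F FP] := choice step.
(* [L n] holds the sets already built. Each has measure $\mu E/2$, and the next set halves it,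
   whence the intersections of measure $\mu E/4$. *)
pose L := fix L n := if n is m.+1 then F (L m) :: L m else [::].
have mL n A : List.In A (L n) -> measurable A.
  elim: n A => [//|n IH] A /= [<-|]; last exact: IH.
  by have [] := FP (L n) IH.
have inL m n : (m < n)%N -> List.In (F (L m)) (L n).
  elim: n => // n IH; rewrite ltnS leq_eqVlt => /predU1P[->|/IH]; by [left|right].
exists (fun n => F (L n)) => n.
have [mF FE Fh Fm] := FP (L n) (mL n); split => // m mn.
rewrite Fm; last exact: inL.
have [_ FE' Fh' _] := FP (L m) (mL m).
by rewrite (setIidr FE') Fh'; lra.
Qed.

(** * Rademacher functions *)

Definition bounded_measurable (d : measure_display) (T : measurableType d)
    (R : realType) (f : T -> R) :=
  measurable_fun setT f /\ exists M, forall x, `|f x| <= M.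

Lemma bounded_measurable_cst (d : measure_display) (T : measurableType d)
    (R : realType) (c : R) : bounded_measurable d T R (fun=> c).
Proof. by split; [exact: measurable_cst|exists `|c|]. Qed.

Lemma bounded_measurableD (d : measure_display) (T : measurableType d)
    (R : realType) (f g : T -> R) :
  bounded_measurable d T R f -> bounded_measurable d T R g ->
  bounded_measurable d T R (fun x => f x + g x).
Proof.
move=> [mf [M hM]] [mg [L hL]]; split; first exact: measurable_funD.
exists (M + L) => x; apply: le_trans (ler_normD _ _) _.
exact: lerD.
Qed.

Lemma bounded_measurableM (d : measure_display) (T : measurableType d)
    (R : realType) (f g : T -> R) :
  bounded_measurable d T R f -> bounded_measurable d T R g ->
  bounded_measurable d T R (fun x => f x * g x).
Proof.
move=> [mf [M hM]] [mg [L hL]]; split; first exact: measurable_funM.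
by exists (M * L) => x; rewrite normrM ler_pM.
Qed.

Lemma bounded_measurable_sum (d : measure_display) (T : measurableType d)
    (R : realType) (f : nat -> T -> R) n :
  (forall k, bounded_measurable d T R (f k)) ->
  bounded_measurable d T R (fun x => \sum_(k < n) f k x).
Proof.
move=> bf; elim: n => [|n IH].
  by under eq_fun do rewrite big_ord0; exact: bounded_measurable_cst.
by under eq_fun do rewrite big_ord_recr/=; exact: bounded_measurableD.
Qed.

Lemma bounded_measurable_indic (d : measure_display) (T : measurableType d)
    (R : realType) (A : set T) : measurable A ->
  bounded_measurable d T R \1_A.
Proof.
move=> mA; split; first exact: measurable_indic.
by exists 1 => x; rewrite indicE ger0_norm ?ler0n// lern1 leq_b1.
Qed.

Lemma bounded_measurable_integrable (d : measure_display) (T : measurableType d)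
    (R : realType) (mu : {measure set T -> \bar R}) (f : T -> R) :
  (mu setT < +oo)%E -> bounded_measurable d T R f ->
  mu.-integrable setT (EFin \o f).
Proof.
move=> fin [mf [M hM]]; apply: measurable_bounded_integrable => //.
exists M; split; first exact: num_real.
by move=> L ML x _ /=; apply: le_trans (hM x) (ltW ML).
Qed.

Lemma Rintegral_indic_setT (d : measure_display) (T : measurableType d)
    (R : realType) (mu : {measure set T -> \bar R}) (A : set T) : measurable A ->
  Rintegral mu setT \1_A = fine (mu A).
Proof. by move=> mA; rewrite /Rintegral integral_indic// setIT. Qed.

(** The integral of $(h - g_n)^2$ is nonnegative, where $g_n$ is the orthogonal projection of $h$ on
    the first $n$ functions. Boundedness makes every product in the expansion integrable. *)
Lemma bessel (d : measure_display) (T : measurableType d) (R : realType)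
    (mu : {measure set T -> \bar R}) (r : nat -> T -> R) (h : T -> R) (a : R) :
  (mu setT < +oo)%E -> 0 < a ->
  (forall n, bounded_measurable d T R (r n)) -> bounded_measurable d T R h ->
  (forall n, Rintegral mu setT (fun x => r n x * r n x) = a) ->
  (forall m n, (m < n)%N -> Rintegral mu setT (fun x => r m x * r n x) = 0) ->
  forall n, \sum_(k < n) (Rintegral mu setT (fun x => h x * r k x)) ^+ 2 <=
    a * Rintegral mu setT (fun x => h x * h x).
Proof.
move=> fin a0 br bh r2 rr.
pose c k := Rintegral mu setT (fun x => h x * r k x) / a.
pose g n x := \sum_(k < n) c k * r k x.
have bZ (b : R) f : bounded_measurable d T R f ->
    bounded_measurable d T R (fun x => b * f x).
  by move=> bf; apply: bounded_measurableM => //; exact: bounded_measurable_cst.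
have bg n : bounded_measurable d T R (g n).
  by apply: (bounded_measurable_sum _ _ _ (fun k x => c k * r k x)) => k; exact: bZ.
have bM := bounded_measurableM d T R.
have int f : bounded_measurable d T R f -> mu.-integrable setT (EFin \o f).
  exact: bounded_measurable_integrable.
have ID f1 f2 : bounded_measurable d T R f1 -> bounded_measurable d T R f2 ->
    Rintegral mu setT (fun x => f1 x + f2 x) =
    Rintegral mu setT f1 + Rintegral mu setT f2.
  by move=> b1 b2; rewrite RintegralD//; exact: int.
have IZ b f : bounded_measurable d T R f ->
    Rintegral mu setT (fun x => b * f x) = b * Rintegral mu setT f.
  by move=> bf; rewrite RintegralZl//; exact: int.
have gr n j : (n <= j)%N -> Rintegral mu setT (fun x => g n x * r j x) = 0.
  elim: n => [_|n IH nj].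
    rewrite (_ : (fun x => _) = fun=> 0); last first.
      by apply/funext => x; rewrite /g big_ord0 mul0r.
    by rewrite Rintegral_cst// mul0r.
  rewrite (_ : (fun x => _) = fun x => g n x * r j x + c n * (r n x * r j x)).
    by rewrite ID ?IZ ?IH ?rr ?mulr0 ?addr0//; [exact: ltnW|exact: bM|exact: bM|exact/bZ/bM].
  by apply/funext => x; rewrite /g big_ord_recr/= mulrDl mulrA.
have hg n : Rintegral mu setT (fun x => (h x - g n x) * (h x - g n x)) =
    Rintegral mu setT (fun x => h x * h x) - a * \sum_(k < n) c k ^+ 2.
  elim: n => [|n IH].
    rewrite big_ord0 mulr0 subr0; congr (Rintegral _ _ _).
    by apply/funext => x; rewrite /g big_ord0 subr0.
  pose f x := (h x - g n x) * (h x - g n x).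
  have bf : bounded_measurable d T R f.
    suff b : bounded_measurable d T R (fun x => h x - g n x) by exact: bM.
    rewrite (_ : (fun x => _) = fun x => h x + (-1) * g n x).
      exact/bounded_measurableD/bZ.
    by apply/funext => x; rewrite mulN1r.
  rewrite (_ : (fun x => _) = fun x => f x + ((- 2 * c n) * (h x * r n x) +
      ((2 * c n) * (g n x * r n x) + c n ^+ 2 * (r n x * r n x)))); last first.
    by apply/funext => x; rewrite /f /g big_ord_recr/=; ring.
  have b1 := bZ (- 2 * c n) _ (bM _ _ bh (br n)).
  have b2 := bZ (2 * c n) _ (bM _ _ (bg n) (br n)).
  have b3 := bZ (c n ^+ 2) _ (bM _ _ (br n) (br n)).
  rewrite ID//; last by apply: bounded_measurableD => //; exact: bounded_measurableD.
  rewrite ID//; last exact: bounded_measurableD.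
  rewrite ID// (IZ _ _ (bM _ _ bh (br n))) (IZ _ _ (bM _ _ (bg n) (br n))).
  rewrite (IZ _ _ (bM _ _ (br n) (br n))) gr// r2 IH big_ord_recr/=.
  rewrite (_ : Rintegral mu setT (fun x => h x * r n x) = a * c n); last first.
    by rewrite /c mulrC divfK ?gt_eqF.
  by ring.
move=> n.
have : 0 <= Rintegral mu setT (fun x => (h x - g n x) * (h x - g n x)).
  by apply: Rintegral_ge0 => x _; rewrite -expr2 sqr_ge0.
rewrite hg subr_ge0 => le.
rewrite (eq_bigr (fun k : 'I_n => (a * a) * c k ^+ 2)); last first.
  move=> k _; rewrite /c expr_div_n; field; exact: lt0r_neq0.
by rewrite -mulr_sumr -mulrA ler_pM2l.
Qed.

(** For bounded functions the squares of the coefficients are summable by Bessel. Simple functions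
    approximate [h] in $L^1$, with an error uniform in [n] because $|r_n| \le 1$. *)
Lemma orthogonal_weakly_null (d : measure_display) (T : measurableType d)
    (R : realType) (mu : {measure set T -> \bar R}) (r : nat -> T -> R)
    (h : T -> R) (a : R) :
  (mu setT < +oo)%E -> 0 < a ->
  (forall n, bounded_measurable d T R (r n)) -> (forall n x, `|r n x| <= 1) ->
  (forall n, Rintegral mu setT (fun x => r n x * r n x) = a) ->
  (forall m n, (m < n)%N -> Rintegral mu setT (fun x => r m x * r n x) = 0) ->
  mu.-integrable setT (EFin \o h) ->
  (fun n => Rintegral mu setT (fun x => r n x * h x)) @ \oo --> (0 : R).
Proof.
move=> fin a0 br r1 r2 rr ih.
have bcase g : bounded_measurable d T R g ->
    (fun n => Rintegral mu setT (fun x => g x * r n x)) @ \oo --> (0 : R).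
  move=> bg; pose c n := Rintegral mu setT (fun x => g x * r n x).
  have cs : cvgn (series (fun n => c n ^+ 2)).
    apply: nondecreasing_is_cvgn.
      by apply/nondecreasing_seqP => n; rewrite !seriesEnat/= big_nat_recr//= lerDl sqr_ge0.
    exists (a * Rintegral mu setT (fun x => g x * g x)) => _ [n _ <-].
    by rewrite seriesEnat/= big_mkord; exact: bessel.
  have /cvgn_eps c0 := cvg_series_cvg_0 cs.
  apply/cvgn_eps => e e0; have [|N HN] := c0 (e ^+ 2); first by rewrite exprn_gt0.
  exists N => n /HN; rewrite !subr0 normrX -/(c n).
  by rewrite ltr_pXn2r// nnegrE// ltW.
apply/cvgn_eps => e e0.
have [g_ [ig _ /fine_fcvg gh]] := approximation_sfun_integrable measurableT ih.
have /cvgn_eps/(_ (e / 2)) [|k Hk] := gh; first by lra.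
pose g : T -> R := g_ k.
have ihg : mu.-integrable setT (EFin \o (fun x => h x - g x)).
  have := integrableB measurableT ih (ig k).
  by apply: eq_integrable => // x _ /=; rewrite EFinB.
have hg : Rintegral mu setT (fun x => `|h x - g x|) < e / 2.
  have := Hk k (leqnn _); rewrite subr0; apply: le_lt_trans.
  exact: ler_norm.
have bg : bounded_measurable d T R g.
  split; first exact: measurable_funP.
  have [M [_ HM]] := simple_bounded (g_ k).
  exists (M + 1) => x; apply: HM => //; lra.
have /cvgn_eps/(_ (e / 2)) [|N HN] := bcase g bg; first by lra.
exists N => n /HN; rewrite !subr0 => hn.
have irhg : mu.-integrable setT (EFin \o (fun x => r n x * (h x - g x))).
  apply: (le_integrable measurableT _ _ ihg).
    apply/measurable_EFinP/measurable_funM; first exact: (br n).1.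
    by apply/measurable_EFinP; case/integrableP: ihg.
  by move=> x _ /=; rewrite lee_fin normrM ler_piMl.
have brg := bounded_measurableM _ _ _ _ _ bg (br n).
rewrite (_ : (fun x => _) = fun x => g x * r n x + r n x * (h x - g x)); last first.
  by apply/funext => x; ring.
rewrite RintegralD//; last exact: bounded_measurable_integrable.
apply: le_lt_trans (ler_normD _ _) _.
suff : `|Rintegral mu setT (fun x => r n x * (h x - g x))| < e / 2 by lra.
apply: le_lt_trans hg; apply: le_trans (le_normr_Rintegral measurableT irhg) _.
apply: le_Rintegral => //; [exact: integrable_norm irhg|exact: integrable_norm ihg|].
by move=> x _; rewrite normrM ler_piMl.
Qed.

Lemma rademacher (d : measure_display) (T : measurableType d) (R : realType)
    (mu : {measure set T -> \bar R}) (E : set T) :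
  atomless mu -> (mu setT < +oo)%E -> measurable E -> (0 < mu E)%E ->
  exists r : nat -> T -> R, [/\ forall n, measurable_fun setT (r n),
    forall n x, `|r n x| = \1_E x &
    forall h, mu.-integrable setT (EFin \o h) ->
      (fun n => Rintegral mu setT (fun x => r n x * h x)) @ \oo --> (0 : R)].
Proof.
move=> al fin mE; rewrite fine_measure_gt0// => E0.
have [B HB] := rademacher_sets _ _ _ mu E al fin mE.
have mB n : measurable (B n) by have [] := HB n.
have BE n : B n `<=` E by have [] := HB n.
(* Values: 1 on [B n], -1 on the rest of [E], 0 elsewhere. *)
pose r n x : R := 2 * \1_(B n) x + (-1) * \1_E x.
have br n : bounded_measurable d T R (r n).
  apply: bounded_measurableD; apply: bounded_measurableM;
    [exact: bounded_measurable_cst|exact: bounded_measurable_indic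
    |exact: bounded_measurable_cst|exact: bounded_measurable_indic].
have rE n x : `|r n x| = \1_E x.
  rewrite /r !indicE; have := BE n x.
  case: (boolP (x \in B n)); case: (boolP (x \in E)); rewrite ?inE => xE xB BEx.
  - by rewrite !mulr1 (_ : 2 + -1 = 1) ?normr1//; lra.
  - by exfalso; move: xE; rewrite notin_setE; apply; exact: BEx.
  - by rewrite mulr0 add0r mulr1 normrN1.
  - by rewrite !mulr0 addr0 normr0.
exists r; split => // [n|h ih]; first exact: (br n).1.
have I1 A : measurable A -> Rintegral mu setT \1_A = fine (mu A).
  exact: Rintegral_indic_setT.
apply: (orthogonal_weakly_null _ _ _ mu r h (fine (mu E))) => //.
- by move=> n x; rewrite rE indicE lern1 leq_b1.
- move=> n; rewrite -I1//; congr (Rintegral _ _ _); apply/funext => x.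
  rewrite -expr2 -real_normK ?num_real// rE indicE.
  by case: (x \in E); rewrite ?expr1n ?expr0n.
- move=> m n mn.
  have [_ _ hn /(_ _ mn) hnm] := HB n; have [_ _ hm _] := HB m.
  have mI := measurableI _ _ (mB n) (mB m).
  have bi A := bounded_measurable_indic d T R A.
  have bZ b f : bounded_measurable d T R f ->
      bounded_measurable d T R (fun x => b * f x).
    by move=> bf; apply: bounded_measurableM => //; exact: bounded_measurable_cst.
  have ii A b : measurable A -> mu.-integrable setT (EFin \o (fun x => b * \1_A x)).
    by move=> mA; apply: bounded_measurable_integrable => //; exact/bZ/bi.
  have iZ A b : measurable A ->
      Rintegral mu setT (fun x => b * \1_A x) = b * fine (mu A).
    move=> mA; rewrite RintegralZl ?I1//.
    by apply: bounded_measurable_integrable => //; exact: bi.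
  (* Its integral is $4 \mu E/4 + \mu E - 2 \mu E/2 - 2 \mu E/2 = 0$. *)
  rewrite (_ : (fun x => _) = fun x => (4 * \1_(B n `&` B m) x + 1 * \1_E x)
     + ((-2) * \1_(B n) x + (-2) * \1_(B m) x)); last first.
    apply/funext => x; rewrite /r !indicE in_setI; have := BE n x; have := BE m x.
    case: (boolP (x \in B n)); case: (boolP (x \in B m)); case: (boolP (x \in E));
      rewrite ?inE ?notin_setE => xE xm xn h1 h2 /=;
      first [lra|by case: xE; apply: h1|by case: xE; apply: h2].
  have bb := bounded_measurable_integrable _ _ _ mu.
  rewrite RintegralD//.
  + by rewrite !RintegralD ?iZ ?ii// hn hm hnm; lra.
  + by apply: bb => //; apply: bounded_measurableD; apply: bZ; exact: bi.
  + by apply: bb => //; apply: bounded_measurableD; apply: bZ; exact: bi.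
Qed.

(** * Schauder bases *)

Lemma bounded_abs_cvgn (R : realType) (x : nat -> R) (M : R) :
  (forall n, \sum_(k < n) `|x k| <= M) -> cvgn (fun n => \sum_(k < n) x k).
Proof.
move=> xM.
have : cvgn (series x).
  apply: normed_cvg; apply: nondecreasing_is_cvgn.
    by apply/nondecreasing_seqP => n /=; rewrite !seriesEnat/= big_nat_recr//= lerDl.
  exists M => _ [n _ <-] /=.
  by rewrite seriesEnat/= big_mkord.
by rewrite seriesEord.
Qed.

Lemma cvgn_norm_le (R : realType) (w : nat -> R) (l M : R) :
  w @ \oo --> l -> (forall n, `|w n| <= M) -> `|l| <= M.
Proof.
move=> /cvgn_eps wl wM; apply/ler_addgt0Pr => e /wl[n /(_ n (leqnn _)) h].
rewrite -(subKr (w n) l); apply: le_trans (ler_normB _ _) _.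
by have := wM n; lra.
Qed.

Definition expands (R : realType) (V : lmodType R) (N : V -> R) (u : nat -> V)
    (f : V) (a : nat -> R) : Prop :=
  (fun n => N (f - \sum_(k < n) a k *: u k)) @ \oo --> (0 : R).

Definition linear_functional (R : realType) (V : lmodType R) (X : set V)
    (phi : V -> R) : Prop :=
  (forall f g, X f -> X g -> phi (f + g) = phi f + phi g) /\
  (forall c f, X f -> phi (c *: f) = c * phi f).

Definition bounded_functional (R : realType) (V : lmodType R) (X : set V)
    (N : V -> R) (phi : V -> R) : Prop :=
  exists C : R, forall f, X f -> `|phi f| <= C * N f.

Definition schauder_basis (R : realType) (V : lmodType R) (X : set V)
    (N : V -> R) (u : nat -> V) : Prop :=
  [/\ (forall k, X (u k)), (forall k, N (u k) = 1),
      (forall f, X f -> exists a, expands R V N u f a) &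
      (forall f a b, X f -> expands R V N u f a -> expands R V N u f b -> a = b)].

Lemma subspace_sum (R : realType) (V : lmodType R) (X : set V) (N : V -> R)
    (u : nat -> V) (a : nat -> R) n :
  seminormed_subspace R V X N -> (forall k, X (u k)) ->
  X (\sum_(k < n) a k *: u k).
Proof.
move=> [[X0 XD XZ] _ _ _ _] Xu; elim: n => [|n IH]; first by rewrite big_ord0.
by rewrite big_ord_recr/=; apply: (XD) => //; exact: XZ.
Qed.

Lemma seminorm_sum_le (R : realType) (V : lmodType R) (X : set V) (N : V -> R)
    (u : nat -> V) (a : nat -> R) n :
  seminormed_subspace R V X N -> (forall k, X (u k)) -> (forall k, N (u k) = 1) ->
  N (\sum_(k < n) a k *: u k) <= \sum_(k < n) `|a k|.
Proof.
move=> XN Xu Nu; have [_ _ N00 _ _] := seminormed_subspaceP _ _ _ _ XN.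
have [[_ _ XZ] _ ND NZ _] := XN.
elim: n => [|n IH]; first by rewrite !big_ord0 N00.
rewrite !big_ord_recr/=; apply: le_trans (ND _ _ _ _) _.
- exact: subspace_sum XN Xu.
- exact: XZ.
- by rewrite NZ// Nu mulr1 lerD2r.
Qed.

Lemma functional_sum (R : realType) (V : lmodType R) (X : set V) (N : V -> R)
    (phi : V -> R) (u : nat -> V) (a : nat -> R) n :
  seminormed_subspace R V X N -> linear_functional R V X phi ->
  (forall k, X (u k)) ->
  phi (\sum_(k < n) a k *: u k) = \sum_(k < n) a k * phi (u k).
Proof.
move=> XN [phiD phiZ] Xu; have [[X0 XD XZ] _ _ _ _] := XN.
elim: n => [|n IH].
  by rewrite !big_ord0 -(scale0r 0) phiZ// mul0r.
rewrite !big_ord_recr/= phiD ?phiZ ?IH//; last exact: XZ.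
exact: subspace_sum XN Xu.
Qed.

Lemma sum_scaleD (R : realType) (V : lmodType R) (u : nat -> V) (a b : nat -> R) n :
  \sum_(k < n) (a k + b k) *: u k =
  \sum_(k < n) a k *: u k + \sum_(k < n) b k *: u k.
Proof. by rewrite -big_split/=; apply: eq_bigr => k _; rewrite scalerDl. Qed.

Lemma sum_scaleB (R : realType) (V : lmodType R) (u : nat -> V) (a b : nat -> R) n :
  \sum_(k < n) (a k - b k) *: u k =
  \sum_(k < n) a k *: u k - \sum_(k < n) b k *: u k.
Proof. by rewrite -sumrB; apply: eq_bigr => k _; rewrite scalerBl. Qed.

Lemma sum_scaleZ (R : realType) (V : lmodType R) (u : nat -> V) c (a : nat -> R) n :
  \sum_(k < n) (c * a k) *: u k = c *: \sum_(k < n) a k *: u k.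
Proof. by rewrite scaler_sumr; apply: eq_bigr => k _; rewrite scalerA. Qed.

Lemma cvgn0_le (R : realType) (v w : nat -> R) :
  (forall n, 0 <= v n <= w n) -> w @ \oo --> (0 : R) -> v @ \oo --> (0 : R).
Proof.
move=> vw /cvgn_eps w0; apply/cvgn_eps => e /w0[M HM]; exists M => n /HM.
have /andP[v0 le] := vw n.
by rewrite !subr0 !ger0_norm//; [exact: le_lt_trans|exact: le_trans le].
Qed.

Lemma expandsD (R : realType) (V : lmodType R) (X : set V) (N : V -> R)
    (u : nat -> V) f g a b :
  seminormed_subspace R V X N -> (forall k, X (u k)) -> X f -> X g ->
  expands R V N u f a -> expands R V N u g b ->
  expands R V N u (f + g) (fun k => a k + b k).
Proof.
move=> XN Xu Xf Xg ea eb.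
have [_ XB _ _ _] := seminormed_subspaceP _ _ _ _ XN.
have [[_ XD _] N0 ND _ _] := XN.
have Xs c n := subspace_sum _ _ _ _ u c n XN Xu.
have h : (fun n => N (f - \sum_(k < n) a k *: u k) +
    N (g - \sum_(k < n) b k *: u k)) @ \oo --> (0 : R).
  by rewrite -[X in _ --> X](addr0 0); exact: cvgD.
apply: (cvgn0_le _ _ _ _ h) => n.
rewrite sum_scaleD opprD addrACA N0/=; last first.
  exact: XD (XB _ _ Xf (Xs a n)) (XB _ _ Xg (Xs b n)).
exact: ND (XB _ _ Xf (Xs a n)) (XB _ _ Xg (Xs b n)).
Qed.

Lemma expandsZ (R : realType) (V : lmodType R) (X : set V) (N : V -> R)
    (u : nat -> V) f c a :
  seminormed_subspace R V X N -> (forall k, X (u k)) -> X f ->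
  expands R V N u f a -> expands R V N u (c *: f) (fun k => c * a k).
Proof.
move=> XN Xu Xf ea.
have [_ XB _ _ _] := seminormed_subspaceP _ _ _ _ XN.
have [_ _ _ NZ _] := XN.
have Xs n := subspace_sum _ _ _ _ u a n XN Xu.
rewrite /expands (_ : (fun n => _) =
    fun n => `|c| * N (f - \sum_(k < n) a k *: u k)).
  by rewrite -(mulr0 `|c|); apply: cvgM => //; exact: cvg_cst.
by apply/funext => n; rewrite sum_scaleZ -scalerBr NZ//; exact: XB.
Qed.

Lemma expandsB (R : realType) (V : lmodType R) (X : set V) (N : V -> R)
    (u : nat -> V) f g a b :
  seminormed_subspace R V X N -> (forall k, X (u k)) -> X f -> X g ->
  expands R V N u f a -> expands R V N u g b ->
  expands R V N u (f - g) (fun k => a k - b k).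
Proof.
move=> XN Xu Xf Xg ea eb; have [[_ _ XZ] _ _ _ _] := XN.
have := expandsD _ _ _ _ _ _ _ _ _ XN Xu Xf (XZ (-1) g Xg) ea
  (expandsZ _ _ _ _ _ _ (-1) _ XN Xu Xg eb).
rewrite scaleN1r (_ : (fun k => _) = (fun k => a k - b k))//.
by apply/funext => k; rewrite mulN1r.
Qed.

Lemma expands_basis (R : realType) (V : lmodType R) (X : set V) (N : V -> R)
    (u : nat -> V) k :
  seminormed_subspace R V X N -> expands R V N u (u k) (fun i => (i == k)%:R).
Proof.
move=> XN; have [_ _ N00 _ _] := seminormed_subspaceP _ _ _ _ XN.
apply/cvgn_eps => e e0; exists k.+1 => n kn.
rewrite (bigD1 (Ordinal kn))//= eqxx scale1r big1 ?addr0 ?subrr ?N00 ?subrr ?normr0//.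
by move=> i; rewrite -val_eqE/= => /negPf ->; rewrite scale0r.
Qed.

Lemma expands_partial_sums_bounded (R : realType) (V : lmodType R) (X : set V)
    (N : V -> R) (u : nat -> V) f a :
  seminormed_subspace R V X N -> (forall k, X (u k)) -> X f ->
  expands R V N u f a -> exists M, forall n, N (\sum_(k < n) a k *: u k) <= M.
Proof.
move=> XN Xu Xf ea.
have [_ XB _ _ NB] := seminormed_subspaceP _ _ _ _ XN.
have Xs n := subspace_sum _ _ _ _ u a n XN Xu.
have /cvg_ex/cvg_seq_bounded[M [_ HM]] : exists l : R,
  (fun n => N (f - \sum_(k < n) a k *: u k)) @ \oo --> l by exists 0.
exists (N f + (M + 1)) => n.
rewrite -(subKr f (\sum_(k < n) _)); apply: le_trans (NB _ _ Xf (XB _ _ Xf (Xs n))) _.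
rewrite lerD2l; apply: le_trans (ler_norm _) _.
by apply: (HM (M + 1)) => //; lra.
Qed.

(** Zabreiko's lemma for the supremum over [n] of the norm of the [n]-th partial sum plus
    $\sum_{k<n} |a_k| b_k$. The first summand controls the individual coefficients, so that the
    coefficients of the approximants converge. *)
Lemma coef_sum_bounded (R : realType) (V : lmodType R) (X : set V) (N : V -> R)
    (u : nat -> V) (b : nat -> R) :
  seminormed_subspace R V X N -> schauder_basis R V X N u ->
  (forall k, 0 <= b k) ->
  (forall f a, X f -> expands R V N u f a ->
     exists M, forall n, \sum_(k < n) `|a k| * b k <= M) ->
  exists2 C, 0 <= C & forall f a, X f -> expands R V N u f a ->
     forall n, \sum_(k < n) `|a k| * b k <= C * N f.
Proof.
move=> XN [Xu Nu ex uniq] b0 bM.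
have [XN' XB N00 NN NB] := seminormed_subspaceP _ _ _ _ XN.
have [[X0 XD XZ] N0 ND NZ _] := XN.
pose P (a : nat -> R) n := \sum_(k < n) a k *: u k.
have XP a n : X (P a n) by exact: subspace_sum XN Xu.
have NP a n : N (P a n) <= \sum_(k < n) `|a k| by exact: seminorm_sum_le XN Xu Nu.
have S0 (a : nat -> R) n : 0 <= \sum_(k < n) `|a k| * b k.
  by apply: sumr_ge0 => k _; rewrite mulr_ge0.
pose B c f := exists2 a, expands R V N u f a &
  forall n, N (P a n) + \sum_(k < n) `|a k| * b k <= c.
have [x Xx|c c' x cc' [a ea ha]|c c' x y Xx Xy [a ea ha] [a' ea' ha']
     |c t x Xx [a ea ha]|y x c Xx Xy y0 yx yB|C C0 HC] := zabreiko R V X N B XN.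
- have [a ea] := ex x Xx; have [M hM] := bM x a Xx ea.
  have [M' hM'] := expands_partial_sums_bounded _ _ _ _ _ _ _ XN Xu Xx ea.
  by exists (M' + M), a => // n; apply: lerD; [exact: hM'|exact: hM].
- by exists a => // n; exact: le_trans (ha n) cc'.
- exists (fun k => a k + a' k); first exact: expandsD XN Xu Xx Xy ea ea'.
  move=> n; apply: le_trans (lerD (ha n) (ha' n)).
  rewrite addrACA lerD//.
    by rewrite /P sum_scaleD; exact: ND (XP a n) (XP a' n).
  rewrite -big_split/=; apply: ler_sum => k _.
  by rewrite -mulrDl ler_wpM2r// ler_normD.
- exists (fun k => t * a k); first exact: expandsZ XN Xu Xx ea.
  move=> n; rewrite /P sum_scaleZ NZ; last exact: XP.
  rewrite (eq_bigr (fun k : 'I_n => `|t| * (`|a k| * b k))); last first.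
    by move=> k _; rewrite normrM mulrA.
  rewrite -mulr_sumr -mulrDr; apply: ler_wpM2l; first exact: normr_ge0.
  exact: ha.
- have yB0 M : exists a, expands R V N u (y M) a /\
      forall n, N (P a n) + \sum_(k < n) `|a k| * b k <= c.
    have [a ea ha] := yB 0%N M (leq0n _).
    by rewrite y0 subr0 in ea; exists a; split => // n; rewrite -[c]divr1; exact: ha.
  have [a aP] := choice yB0.
  have ea M : expands R V N u (y M) (a M) by have [] := aP M.
  have ha M n : N (P (a M) n) + \sum_(k < n) `|a M k| * b k <= c.
    by have [_] := aP M; apply.
  have hd I M n : (I <= M)%N -> N (P (a M) n - P (a I) n) <= c / 2 ^+ I.
    move=> IM; have [a' ea' ha'] := yB I M IM.
    have := expandsB _ _ _ _ _ _ _ _ _ XN Xu (Xy M) (Xy I) (ea M) (ea I).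
    move=> /(uniq _ _ _ (XB _ _ (Xy M) (Xy I)) ea') E.
    have := ha' n; rewrite E /P sum_scaleB => h.
    by apply: le_trans h; rewrite lerDl; exact: (S0 (fun k => a M k - a I k)).
  (* A term of the expansion is a difference of consecutive partial sums, and [u k] has norm 1. *)
  have hk I M k : (I <= M)%N -> `|a M k - a I k| <= 2 * (c / 2 ^+ I).
    move=> IM; have -> : `|a M k - a I k| = N ((a M k - a I k) *: u k).
      by rewrite NZ// Nu mulr1.
    have -> : (a M k - a I k) *: u k =
        (P (a M) k.+1 - P (a I) k.+1) - (P (a M) k - P (a I) k).
      by rewrite /P -!sum_scaleB big_ord_recr/= addrAC subrr add0r.
    apply: le_trans (NB _ _ (XB _ _ (XP _ _) (XP _ _)) (XB _ _ (XP _ _) (XP _ _))) _.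
    rewrite mulr_natl mulr2n.
    exact: lerD (hd I M k.+1 IM) (hd I M k IM).
  have ak k : exists l : R, (fun M => a M k) @ \oo --> l.
    apply/cvg_ex/cauchy_cvgP/cauchy_exP => e e0.
    have /cvgn_eps/(_ (e / 2)) [|I HI] := cvgn_geo_half R c; first by lra.
    have := HI I (leqnn _); rewrite subr0 => /(le_lt_trans (ler_norm _)) hI.
    exists (a I k), I => // M IM; rewrite /ball/= distrC.
    by apply: le_lt_trans (hk I M k IM) _; move: hI; set q := c / _; lra.
  have [A AP] := choice ak.
  have lim0 (w : nat -> R) n :
      (fun M => \sum_(k < n) `|a M k - A k| * w k) @ \oo --> (0 : R).
    elim: n => [|n IH].
      by under eq_fun do rewrite big_ord0; exact: cvg_cst.
    have h1 : (fun M => `|a M n - A n|) @ \oo --> (0 : R).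
      rewrite -[X in _ --> X](normr0 R) -[X in `|X|](subrr (A n)).
      by apply: cvg_norm; apply: cvgB; [exact: AP|exact: cvg_cst].
    have h2 : (fun M => `|a M n - A n| * w n) @ \oo --> (0 : R).
      by rewrite -[X in _ --> X](mul0r (w n)); apply: cvgM => //; exact: cvg_cst.
    rewrite (_ : (fun M => _) = (fun M =>
        \sum_(k < n) `|a M k - A k| * w k + `|a M n - A n| * w n)).
      by rewrite -[X in _ --> X](addr0 0); exact: cvgD.
    by apply/funext => M; rewrite big_ord_recr.
  have PA M n : N (P (a M) n - P A n) <= \sum_(k < n) `|a M k - A k| * 1.
    rewrite /P -sum_scaleB; apply: le_trans (NP (fun k => a M k - A k) n) _.
    by under [leRHS]eq_bigr do rewrite mulr1.
  (* Coefficients converge only coordinatewise, so the order of choices matters: [I] first, then [n]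
     large for the expansion of [y I], then [M] depending on [n]. The estimate [hd], uniform in [n]
     and [M], bridges [I] and [M]. *)
  exists A.
    apply/cvgn_eps => e e0.
    have e4 : 0 < e / 4 by lra.
    have /cvgn_eps/(_ _ e4)[I1 h1] := yx.
    have /cvgn_eps/(_ _ e4)[I2 h2] := cvgn_geo_half R c.
    pose I := maxn I1 I2.
    have {}h1 := h1 I (leq_maxl _ _); have {}h2 := h2 I (leq_maxr _ _).
    have /cvgn_eps/(_ _ e4)[n0 h3] := ea I.
    exists n0 => n /h3 {}h3.
    have /cvgn_eps/(_ _ e4)[M0 h4] := lim0 (fun=> 1) n.
    pose M := maxn M0 I.
    have {}h4 := h4 M (leq_maxl _ _).
    rewrite !subr0 in h1 h2 h3 h4 *.
    have h5 := hd I M n (leq_maxr _ _).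
    have h6 := PA M n.
    move: h1 h2 h3 h4 => /(le_lt_trans (ler_norm _)) h1
      /(le_lt_trans (ler_norm _)) h2 /(le_lt_trans (ler_norm _)) h3
      /(le_lt_trans (ler_norm _)) h4.
    rewrite ger0_norm; last exact: (N0 _ (XB _ _ Xx (XP A n))).
    have Xd := XB _ _ Xx (Xy I).
    have -> : x - \sum_(k < n) A k *: u k = ((x - y I) + (y I - P (a I) n)) +
        ((P (a M) n - P A n) - (P (a M) n - P (a I) n)).
      by rewrite opprB [P (a M) n - _ + _]addrC !subrKA.
    apply: le_lt_trans (ND _ _ _ _) _.
    + by apply: (XD) => //; exact: XB.
    + by apply: (XB); exact: XB.
    apply: le_lt_trans (lerD (ND _ _ _ _) (NB _ _ _ _)) _ => //; try exact: XB.
    by rewrite -/(P (a I) n) in h3; lra.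
  move=> n; apply/ler_addgt0Pr => e e0.
  have /cvgn_eps/(_ e e0)[M0 h4] := lim0 (fun k => 1 + b k) n.
  have := h4 M0 (leqnn _); rewrite subr0 => /(le_lt_trans (ler_norm _)) {}h4.
  have h1 := ha M0 n; have h2 := PA M0 n.
  have h3 : N (P A n) <= N (P (a M0) n) + N (P (a M0) n - P A n).
    rewrite -{1}(subKr (P (a M0) n) (P A n)).
    by apply: NB => //; exact: XB.
  have h5 : \sum_(k < n) `|A k| * b k <=
      \sum_(k < n) `|a M0 k| * b k + \sum_(k < n) `|a M0 k - A k| * b k.
    rewrite -big_split/=; apply: ler_sum => k _; rewrite -mulrDl ler_wpM2r//.
    by rewrite -{1}(subKr (a M0 k) (A k)); exact: ler_normB.
  have h6 : \sum_(k < n) `|a M0 k - A k| * (1 + b k) =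
      \sum_(k < n) `|a M0 k - A k| * 1 + \sum_(k < n) `|a M0 k - A k| * b k.
    by rewrite -big_split/=; apply: eq_bigr => k _; rewrite mulrDr.
  lra.
- exists C => // f a Xf ea n.
  apply/ler_addgt0Pr => e e0.
  have C1 : 0 < C + 1 by lra.
  (* Zabreiko's bound needs a value strictly above [N f]; [C + 1] is positive even when [C]
     vanishes. *)
  have [|a' ea' ha'] := HC f (N f + e / (C + 1)) Xf.
    by rewrite ltrDl divr_gt0.
  rewrite (uniq _ _ _ Xf ea ea').
  have := ha' n; rewrite mulrDr => h.
  have := N0 _ (XP a' n).
  have : C * (e / (C + 1)) <= e.
    by rewrite mulrA ler_pdivrMr// mulrC ler_pM2l//; lra.
  by lra.
Qed.

Lemma coef_functional (R : realType) (V : lmodType R) (X : set V) (N : V -> R)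
    (u : nat -> V) (b : nat -> R) (C : R) :
  seminormed_subspace R V X N -> schauder_basis R V X N u ->
  (forall f a, X f -> expands R V N u f a ->
     cvgn (fun n => \sum_(k < n) a k * b k) /\
     `|limn (fun n => \sum_(k < n) a k * b k)| <= C * N f) ->
  exists phi, [/\ linear_functional R V X phi, bounded_functional R V X N phi &
    forall f a, X f -> expands R V N u f a ->
      (fun n => \sum_(k < n) a k * b k) @ \oo --> phi f].
Proof.
move=> XN [Xu Nu ex uniq] H; have [[X0 XD XZ] _ _ _ _] := XN.
have coefX f : exists a, X f -> expands R V N u f a.
  by have [/ex[a]|] := pselect (X f); [exists a|exists (fun=> 0)].
have [A AP] := choice coefX.
pose phi f := limn (fun n => \sum_(k < n) A f k * b k).
have phiP f a : X f -> expands R V N u f a ->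
    (fun n => \sum_(k < n) a k * b k) @ \oo --> phi f.
  by move=> Xf ea; rewrite (uniq _ _ _ Xf ea (AP f Xf)); exact: (H _ _ Xf (AP f Xf)).1.
exists phi; split => //; last by exists C => f Xf; exact: (H _ _ Xf (AP f Xf)).2.
split=> [f g Xf Xg|c f Xf].
  have e := expandsD _ _ _ _ _ _ _ _ _ XN Xu Xf Xg (AP f Xf) (AP g Xg).
  apply: (cvg_unique _ (phiP _ _ (XD _ _ Xf Xg) e)) => //.
  have h : (fun n => \sum_(k < n) A f k * b k + \sum_(k < n) A g k * b k) @ \oo
      --> phi f + phi g by apply: cvgD; exact/phiP/AP.
  apply: cvg_trans h; apply: near_eq_cvg; apply: nearW => n.
  by rewrite -big_split/=; apply: eq_bigr => k _; rewrite mulrDl.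
have e := expandsZ _ _ _ _ _ _ c _ XN Xu Xf (AP f Xf).
apply: (cvg_unique _ (phiP _ _ (XZ c _ Xf) e)) => //.
have h : (fun n => c * \sum_(k < n) A f k * b k) @ \oo --> c * phi f.
  by apply: cvgM; [exact: cvg_cst|exact/phiP/AP].
apply: cvg_trans h; apply: near_eq_cvg; apply: nearW => n.
by rewrite mulr_sumr; apply: eq_bigr => k _; rewrite mulrA.
Qed.

(** The map $f \mapsto (a_k \varphi(u_k))_k$ is bounded into $l^1$, so bounded sequences pull back
    to bounded functionals on [X] and weak nullity of [r] passes to $l^1$. *)
Lemma weakly_null_coef_sums (R : realType) (V : lmodType R) (X : set V) (N : V -> R)
    (u : nat -> V) (phi : V -> R) (r : nat -> V) :
  seminormed_subspace R V X N -> schauder_basis R V X N u ->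
  (forall f a s, X f -> expands R V N u f a -> bijective s ->
     expands R V N (u \o s) f (a \o s)) ->
  linear_functional R V X phi -> bounded_functional R V X N phi ->
  (forall k, 0 <= phi (u k)) -> (forall n, X (r n)) ->
  (forall psi, linear_functional R V X psi -> bounded_functional R V X N psi ->
     (fun n => psi (r n)) @ \oo --> (0 : R)) ->
  forall e, 0 < e -> exists n a, expands R V N u (r n) a /\
    forall m, \sum_(k < m) `|a k| * phi (u k) < e.
Proof.
move=> XN bas unc lphi [C0 bphi] phi0 Xr weak.
have [Xu Nu ex uniq] := bas.
have [_ XB _ _ NB] := seminormed_subspaceP _ _ _ _ XN.
have [_ N0 _ _ _] := XN.
pose b k := phi (u k).
have phiB f g : X f -> X g -> phi (f - g) = phi f - phi g.
  move=> Xf Xg; have [phiD phiZ] := lphi; have [[_ _ XZ] _ _ _ _] := XN.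
  by rewrite -scaleN1r phiD ?phiZ ?mulN1r//; exact: XZ.
have absb f a : X f -> expands R V N u f a ->
    exists M, forall n, \sum_(k < n) `|a k| * b k <= M.
  (* A rearranged expansion still converges to [f], and the bounded functional [phi] maps it to a
     series with sum [phi f]. *)
  move=> Xf ea; have [s bs|M HM] := rearrangements_cvg_bounded R (fun k => a k * b k).
    apply/cvg_ex; exists (phi f); apply/cvgn_eps => e e0.
    have := unc f a s Xf ea bs => /cvgn_eps/(_ (e / (`|C0| + 1))) [|M HM].
      by rewrite divr_gt0// ltr_wpDl.
    exists M => n /HM; rewrite subr0 distrC => h.
    have Xus k : X ((u \o s) k) by exact: Xu.
    have Xs := subspace_sum _ _ _ _ (u \o s) (a \o s) n XN Xus.
    rewrite -(functional_sum _ _ _ _ _ (u \o s) (a \o s) n XN lphi Xus) -phiB//.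
    apply: le_lt_trans (bphi _ (XB _ _ Xf Xs)) _.
    have N0s := N0 _ (XB _ _ Xf Xs).
    rewrite (ger0_norm N0s) in h.
    have C1 : 0 < `|C0| + 1 by rewrite ltr_wpDl.
    rewrite ltr_pdivlMr// mulrC in h; apply: le_lt_trans h.
    by rewrite ler_wpM2r//; have := ler_norm C0; lra.
  exists M => n; apply: le_trans (HM n); apply: ler_sum => k _.
  by rewrite normrM (ger0_norm (phi0 k)).
have [C C_ge0 HC] := coef_sum_bounded _ _ _ _ _ _ XN bas phi0 absb.
have [a aP] := choice (fun n => ex _ (Xr n)).
have nb n k : `|a n k * b k| = `|a n k| * b k by rewrite normrM (ger0_norm (phi0 k)).
move=> e e0.
have [n|th th1 d d0|n Hn] := schur_l1 R (fun n k => a n k * b k) _ _ e e0.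
- exists (C * N (r n)) => m; under eq_bigr do rewrite nb.
  exact: HC.
- have absth f c n : X f -> expands R V N u f c ->
      \sum_(k < n) `|c k * (th k * b k)| <= C * N f.
    move=> Xf ec; apply: le_trans (HC _ _ Xf ec n); apply: ler_sum => k _.
    rewrite !normrM (ger0_norm (phi0 k)) ler_wpM2l//.
    by rewrite ler_piMl.
  have [f c Xf ec|psi [lpsi bpsi psiP]] :=
      coef_functional _ _ _ _ _ (fun k => th k * b k) C XN bas.
    have cv := bounded_abs_cvgn R (fun k => c k * (th k * b k)) _ (fun n => absth f c n Xf ec).
    split => //; apply: cvgn_norm_le cv _ => n.
    by apply: le_trans (ler_norm_sum _ _ _) _; exact: absth.
  have /cvgn_eps/(_ (d / 2)) [|n0 Hn0] := weak psi lpsi bpsi; first by lra.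
  exists n0 => n /Hn0; rewrite subr0 => h.
  have /cvgn_eps/(_ (d / 2)) [|m0 Hm0] := psiP _ _ (Xr n) (aP n); first by lra.
  exists m0 => m /Hm0 h'.
  rewrite (eq_bigr (fun k : 'I_m => a n k * (th k * b k))); last first.
    by move=> k _; rewrite mulrCA.
  rewrite -(subrK (psi (r n)) (\sum_(k < m) _)).
  by apply: le_lt_trans (ler_normD _ _) _; lra.
- exists n, (a n); split => // m.
  by have := Hn m; under eq_bigr do rewrite nb.
Qed.

(** * Banach function lattices *)

(** The module operations of [T -> R^o] unfold to the pointwise ones, so every field carries over by
    conversion. *)
Lemma bfl_seminormed (d : measure_display) (T : measurableType d) (R : realType)
    (mu : {measure set T -> \bar R}) (X : set (T -> R)) (nrm : (T -> R) -> R) :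
  banach_function_lattice mu X nrm ->
  seminormed_subspace R (T -> R^o) X nrm.
Proof.
move=> [[_ X0 XD XZ] [N0 ND NZ _] _ Xc]; split => //.
Qed.

Lemma is_coefE (d : measure_display) (T : measurableType d) (R : realType)
    (nrm : (T -> R) -> R)
    (u : nat -> T -> R) (f : T -> R) (a : nat -> R) :
  is_coef nrm u f a = expands R (T -> R^o) nrm u f a.
Proof.
rewrite /is_coef (_ : (fun n => _) =
    fun n => nrm (f - \sum_(k < n) a k *: (u k : T -> R^o)))//.
apply/funext => n; congr nrm; apply/funext => x.
by rewrite /= fct_sumE.
Qed.

(** As [X] lies in $L^1$, the constant 1 belongs to the Koethe dual and integration is bounded on
    [X]. The ideal property allows applying this to $|f| 1_E$. *)
Lemma L1_norm_bound (d : measure_display) (T : measurableType d) (R : realType)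
    (mu : {measure set T -> \bar R}) (X : set (T -> R)) (nrm : (T -> R) -> R)
    (E : set T) :
  banach_function_lattice mu X nrm -> sub_L1 mu X -> dual_is_kothe mu X nrm ->
  measurable E ->
  exists2 C, 0 <= C & forall f, X f -> Rintegral mu E (fun x => `|f x|) <= C * nrm f.
Proof.
move=> [[Xm _ _ _] [N0 _ _ _] Xi _] XL [bdd _] mE.
have [|C HC] := bdd (fun=> 1).
  split; first exact: measurable_cst.
  move=> f Xf; rewrite (_ : (fun x => f x * 1) = f); first exact: XL.
  by apply/funext => x; rewrite mulr1.
exists `|C| => // f Xf.
have mg : measurable_fun setT (fun x => `|f x| * \1_E x).
  apply: measurable_funM; last exact: measurable_indic.
  by apply: measurableT_comp => //; exact: Xm.
have [|Xg Ng] := Xi _ f Xf mg.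
  apply: aeW => x; rewrite normrM normr_id ler_piMr//.
  by rewrite indicE ger0_norm ?ler0n// lern1 leq_b1.
have := HC _ Xg; rewrite /pairing.
rewrite (_ : (fun x => _ * 1) = (fun x => `|f x|) \_ E); last first.
  apply/funext => x; rewrite mulr1 patchE indicE.
  by case: (x \in E); rewrite ?mulr1 ?mulr0.
rewrite -Rintegral_mkcond => /(le_trans (ler_norm _)) h.
apply: le_trans h _; apply: (@le_trans _ _ (`|C| * nrm (fun x => `|f x| * \1_E x))).
  by rewrite ler_wpM2r ?ler_norm// N0.
by rewrite ler_wpM2l.
Qed.

(* With [b_k] the integrals of [|u_k|], [L^1(E)]-norms are dominated by the sums of [|a_k| b_k], which tend to 0 along a Rademacher sequence. *)
Lemma no_functional_abs_integral (d : measure_display) (T : measurableType d)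
    (R : realType) (mu : {measure set T -> \bar R})
    (X : set (T -> R)) (nrm : (T -> R) -> R) (u : nat -> T -> R)
    (E : set T) (phi : (T -> R) -> R) :
  atomless mu -> (mu setT < +oo)%E ->
  banach_function_lattice mu X nrm ->
  Linfty_sub mu X -> sub_L1 mu X -> dual_is_kothe mu X nrm ->
  normalized_unconditional_basis X nrm u ->
  measurable E -> (0 < mu E)%E ->
  linear_on X phi -> bounded_on X nrm phi ->
  ~ (forall k, phi (u k) = Rintegral mu E (fun x => `|u k x|)).
Proof.
move=> al fin bfl XLi XL1 dual [Xu Nu ex uniq unc] mE muE lphi bphi phiu.
have XN := bfl_seminormed _ _ _ _ _ _ bfl.
have [C C0 HC] := L1_norm_bound _ _ _ _ _ _ _ bfl XL1 dual mE.
have [_ kdual] := dual.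
have X1 : X (fun=> 1).
  by apply: XLi; [exact: measurable_cst|exists 1; apply: aeW => x; rewrite normr1].
have [r [mr rE rw]] := rademacher _ _ _ mu E al fin mE muE.
have Xr n : X (r n).
  apply: XLi => //; exists 1; apply: aeW => x.
  by rewrite rE indicE lern1 leq_b1.
have bas : schauder_basis R (T -> R^o) X nrm u.
  split => //.
    by move=> f /ex[a]; rewrite is_coefE => ?; exists a.
  by move=> f a b Xf; rewrite -!is_coefE; exact: uniq.
have int f : X f -> mu.-integrable E (EFin \o (fun x => `|f x|)).
  move=> Xf; apply: (integrableS measurableT) => //.
  exact: integrable_norm (XL1 _ Xf).
pose p (f : T -> R) := Rintegral mu E (fun x => `|f x|).
have m0 : 0 < fine (mu E) by rewrite -fine_measure_gt0.
have [f a s|k|psi lpsi bpsi||n [a [ea ha]]] := weakly_null_coef_sums R (T -> R^o) X nrm u phi r XN bas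
    _ lphi bphi _ Xr _ (fine (mu E) / 2).
- by rewrite -!is_coefE; exact: unc.
- by rewrite phiu; exact: Rintegral_ge0.
(* The representing [h] is integrable because it pairs integrably with the constant 1. *)
- have [h [[mh Kh] hE]] := kdual psi lpsi bpsi.
  rewrite (_ : (fun n => _) = (fun n => Rintegral mu setT (fun x => r n x * h x))).
    apply: rw; have := Kh _ X1; rewrite (_ : (fun x => 1 * h x) = h)//.
    by apply/funext => x; rewrite mul1r.
  by apply/funext => n; rewrite hE.
- by lra.
have pr : p (r n) = fine (mu E).
  rewrite -[RHS]mul1r -(Rintegral_cst mu mE 1); apply: eq_Rintegral => x xE.
  by rewrite rE indicE xE.
have XP m : X (\sum_(k < m) a k *: (u k : T -> R^o)).
  exact: (subspace_sum _ _ _ _ _ _ _ XN Xu).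
have [[_ XD XZ] _ _ _ _] := XN.
have pD f g : X f -> X g -> p (fun x => f x + g x) <= p f + p g.
  move=> Xf Xg; rewrite /p -RintegralD//; [|exact: int|exact: int].
  apply: le_Rintegral => //; first by apply: int; exact: XD.
    have := integrableD mE (int _ Xf) (int _ Xg).
    by apply: eq_integrable.
  by move=> x _; exact: ler_normD.
have pZ c f : X f -> p (fun x => c * f x) = `|c| * p f.
  move=> Xf; rewrite /p -RintegralZl//; last exact: int.
  by congr Rintegral; apply/funext => x; rewrite normrM.
have psum m : p (\sum_(k < m) a k *: (u k : T -> R^o)) <= \sum_(k < m) `|a k| * p (u k).
  elim: m => [|m IH].
    rewrite !big_ord0 -[leRHS](mul0r (fine (mu E))) -(Rintegral_cst mu mE 0).
    by rewrite le_eqVlt; apply/orP; left; apply/eqP/eq_Rintegral => x _; rewrite normr0.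
  rewrite !big_ord_recr/=; apply: le_trans (pD _ _ (XP m) (XZ (a m) _ (Xu m))) _.
  by rewrite pZ// lerD.
(* Both the expansion error in $L^1(E)$ and the coefficient sum then stay within $\mu E/2$, the
   latter strictly, while $\int_E |r_n| = \mu E$. *)
have /cvgn_eps/(_ (fine (mu E) / 2 / (C + 1))) [|M /(_ M (leqnn _))] := ea.
  by rewrite !divr_gt0//; lra.
rewrite subr0 => /(le_lt_trans (ler_norm _)) hM.
have XB := XD _ _ (Xr n) (XZ (-1) _ (XP M)).
rewrite scaleN1r in XB.
have h1 := HC _ XB.
have h2 : p (r n) <= p (r n - \sum_(k < M) a k *: (u k : T -> R^o)) +
    p (\sum_(k < M) a k *: (u k : T -> R^o)).
  have := pD _ _ XB (XP M); congr (p _ <= _).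
  by apply/funext => x /=; exact: subrK.
have h4 := psum M.
have : C * (fine (mu E) / 2 / (C + 1)) <= fine (mu E) / 2.
  by rewrite mulrA ler_pdivrMr; [nra|lra].
have : C * nrm (r n - \sum_(k < M) a k *: (u k : T -> R^o)) <=
    C * (fine (mu E) / 2 / (C + 1)).
  by rewrite ler_wpM2l// ltW.
have h5 : \sum_(k < M) `|a k| * p (u k) < fine (mu E) / 2.
  by have := ha M; under eq_bigr do rewrite phiu.
rewrite /p in h1 h2 h4 h5 pr *; lra.
Qed.

Theorem theorem2p6 (d : measure_display) (T : measurableType d) (R : realType)
  (mu : {measure set T -> \bar R})
  (X : set (T -> R)) (nrm : (T -> R) -> R) (u : nat -> T -> R) :
  atomless mu -> (mu setT < +oo)%E ->
  banach_function_lattice mu X nrm ->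
  Linfty_sub mu X -> sub_L1 mu X ->
  dual_is_kothe mu X nrm -> reflexive_space mu X nrm ->
  normalized_unconditional_basis X nrm u ->
  forall E : set T, measurable E -> (0 < mu E)%E ->
    ~ in_coef_dual X nrm u (fun k => Rintegral mu E (fun x => Num.max (u k x) 0))
    /\ ~ in_coef_dual X nrm u (fun k => Rintegral mu E (fun x => Num.max (- u k x) 0)).
Proof.
move=> al fin bfl XLi XL1 dual _ nub E mE muE.
have XN := bfl_seminormed _ _ _ _ _ _ bfl.
have [C C0 HC] := L1_norm_bound _ _ _ _ _ _ _ bfl XL1 dual mE.
have [Xu Nu ex uniq _] := nub.
have bas : schauder_basis R (T -> R^o) X nrm u.
  split => //.
    by move=> f /ex[a]; rewrite is_coefE => ?; exists a.
  by move=> f a b Xf; rewrite -!is_coefE; exact: uniq.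
have int f : X f -> mu.-integrable E (EFin \o f).
  by move=> Xf; apply: (integrableS measurableT) => //; exact: XL1.
(* [|t| = 2 t^+ - t = 2 t^- + t] *)
have key (v : R -> R) (c : R) : measurable_fun setT v ->
    (forall t, 0 <= v t <= `|t|) -> (forall t, 2 * v t + c * t = `|t|) ->
    ~ in_coef_dual X nrm u (fun k => Rintegral mu E (fun x => v (u k x))).
  move=> mv vt vc [cvb [B HB]].
  have [f a Xf|psi [[psiD psiZ] [B' HB'] psiP]] := coef_functional R (T -> R^o) X nrm u
      (fun k => Rintegral mu E (fun x => v (u k x))) B XN bas.
    by rewrite -is_coefE => ea; split; [exact: (cvb _ _ Xf ea)|exact: (HB _ _ Xf ea)].
  (* [psi] is given through expansions, and that of [u k] is the [k]-th unit sequence. *)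
  have psiu k : psi (u k) = Rintegral mu E (fun x => v (u k x)).
    apply: (cvg_unique _ (psiP _ _ (Xu k) (expands_basis _ _ _ _ _ k XN))) => //.
    apply/cvgn_eps => e e0; exists k.+1 => n kn.
    rewrite (bigD1 (Ordinal kn))//= eqxx mul1r big1 ?addr0 ?subrr ?normr0//.
    by move=> i; rewrite -val_eqE/= => /negPf ->; rewrite mul0r.
  (* The correction by the integral over [E] turns the values at the basis into the integrals of
     $|u_k|$, and it is bounded on [X] by the $L^1$ bound. *)
  pose phi f := 2 * psi f + c * Rintegral mu E f.
  apply: (no_functional_abs_integral _ _ _ _ _ _ _ E phi al fin bfl XLi XL1 dual nub mE muE).
  - split=> [f g Xf Xg|b f Xf]; rewrite /phi.
      by rewrite psiD// RintegralD//; [ring|exact: int|exact: int].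
    by rewrite psiZ// RintegralZl//; [ring|exact: int].
  - exists (2 * B' + `|c| * C) => f Xf.
    apply: le_trans (ler_normD _ _) _.
    rewrite !normrM [`|2|]ger0_norm// [leRHS]mulrDl -!mulrA lerD//.
      by rewrite ler_pM2l//; exact: (HB' _ Xf).
    rewrite ler_wpM2l//; apply: le_trans (HC _ Xf).
    by apply: le_normr_Rintegral => //; exact: int.
  - have iv k : mu.-integrable E (EFin \o (fun x => v (u k x))).
      apply: (le_integrable mE _ _ (int _ (Xu k))).
        apply/measurable_EFinP; apply: measurable_funTS.
        apply: measurableT_comp => //.
        by have [[Xm _ _ _] _ _ _] := bfl; exact: Xm.
      move=> x _ /=; rewrite lee_fin.
      by have /andP[v0 le] := vt (u k x); rewrite ger0_norm.
    move=> k; rewrite /phi psiu -!RintegralZl//; last exact: int.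
    rewrite -RintegralD//.
    + by congr Rintegral; apply/funext => x; exact: vc.
    + have := integrableZl mE 2 (iv k).
      by apply: eq_integrable.
    + have := integrableZl mE c (int _ (Xu k)).
      by apply: eq_integrable.
split.
- apply: (key (fun t => Num.max t 0) (-1)).
  + exact: measurable_maxr.
  + by move=> t; case: (lerP t 0) => t0; rewrite ?lexx ?normr_ge0//= ler_norm ltW.
  + by move=> t; case: (lerP t 0) => t0; [rewrite ler0_norm//|rewrite gtr0_norm//]; lra.
- apply: (key (fun t => Num.max (- t) 0) 1).
  + exact: measurable_maxr.
  + move=> t; case: (lerP (- t) 0) => t0; rewrite ?lexx ?normr_ge0//=.
    by rewrite (ltW t0) -normrN ler_norm.
  + move=> t; case: (lerP (- t) 0) => t0; [rewrite ger0_norm|rewrite ltr0_norm]; lra.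
Qed.
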